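(* Let $M=G/H$ be a homogeneous space of a compact semisimple Lie group $G$ ($H$ a closed subgroup of $G$), with reductive decomposition $\mathfrak{g}=\mathfrak{h}\oplus\mathfrak{m}$, where $\mathfrak{m}$ is the orthogonal complement of $\mathfrak{h}$ with respect to $-B$. Let $K$ be a closed subgroup of $G$ such that $H\subset K\subset N_G(H)$, where $N_G(H)=\{g\in G: gHg^{-1}=H\}$ is the normalizer of $H$ in $G$. Put $\Phi=\{\phi=\mathrm{Ad}(n)|_{\mathfrak{m}} : n\in N_G(H)\}$ and $\Phi_K=\{\varphi=\mathrm{Ad}(k)|_{\mathfrak{m}} : k\in K\}$, so that $\Phi_K\subset\Phi\subset\mathrm{Aut}(\mathfrak{m})$. Let $\mathcal{M}^G$ be the set of all $G$-invariant metrics on $G/H$, identified with the set of operators $A:\mathfrak{m}\to\mathfrak{m}$ described in the context. Then: (1) The action $(\varphi,A)\mapsto\varphi\circ A\circ\varphi^{-1}$ of $\Phi_K$ on $\mathcal{M}^G$ is well defined. (2) The set $(\mathcal{M}^G)^{\Phi_K}=\{A\in\mathcal{M}^G : \varphi\circ A\circ\varphi^{-1}=A \text{ for all } \varphi\in\Phi_K\}$ of fixed points of the action in (1) determines, via $A\mapsto\langle\cdot,\cdot\rangle_A$, a subset of the set of all $\mathrm{Ad}(H)$-invariant inner products on $\mathfrak{m}$, namely the set of $\mathrm{Ad}(K)$-invariant inner products on $\mathfrak{m}$. This set in turn determines, via the correspondence between $\mathrm{Ad}(H)$-invariant inner products on $\mathfrak{m}$ and $G$-invariant metrics on $G/H$,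 a subset $\mathcal{M}^{G,K}$ of $\mathcal{M}^G$.
   Context: $\mathfrak{g},\mathfrak{h}$ are the Lie algebras of $G,H$, and $B$ is the Killing form of $\mathfrak{g}$; since $G$ is compact and semisimple, $-B$ is an $\mathrm{Ad}(G)$-invariant inner product on $\mathfrak{g}$. The space $\mathfrak{m}$ is $\mathrm{Ad}(H)$-invariant and is identified with the tangent space $T_o(G/H)$ at $o=eH$. $\mathrm{Aut}(\mathfrak{m})$ denotes the group of linear automorphisms of the vector space $\mathfrak{m}$. A Riemannian metric on $G/H$ is $G$-invariant if every translation $\tau_a:gH\mapsto agH$ ($a\in G$) is an isometry. The $G$-invariant metrics on $G/H$ are in one-to-one correspondence (by restriction to $T_o(G/H)\cong\mathfrak{m}$) with the $\mathrm{Ad}(H)$-invariant inner products on $\mathfrak{m}$. These in turn are in one-to-one correspondence with the linear operators $A:\mathfrak{m}\to\mathfrak{m}$ that are $\mathrm{Ad}(H)$-equivariant (i.e. $\mathrm{Ad}(h)|_{\mathfrak{m}}\circ A=A\circ\mathrm{Ad}(h)|_{\mathfrak{m}}$ for all $h\in H$), symmetric with respect to $-B$, and positive definite with respect to $-B$, via $\langle X,Y\rangle_A=-B(AX,Y)$. The set $\mathcal{M}^G$ is identified with the set of these operators $A$. For a subgroup $K$ with $H\subset K\subset N_G(H)$, an inner product $\langle\cdot,\cdot\rangle$ on $\mathfrak{m}$ is called $\mathrm{Ad}(K)$-invariant if $\langle\mathrm{Ad}(k)X,\mathrm{Ad}(k)Y\rangle=\langle X,Y\rangle$ for all $k\in K$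 and $X,Y\in\mathfrak{m}$. *)

(* Defs.v *)
From HB Require Import structures.
From mathcomp Require Import all_boot all_order all_algebra.
From mathcomp Require Import all_classical all_reals all_analysis.

Set Implicit Arguments.
Unset Strict Implicit.
Unset Printing Implicit Defensive.

Import Order.TTheory GRing.Theory Num.Theory.
Import numFieldNormedType.Exports.

Local Open Scope classical_set_scope.
Local Open Scope ring_scope.

(* Only the two structures are joined here: continuity of the group operations
   is part of [lie_group] below. *)
#[short(type="topoGroupType")]
HB.structure Definition TopoGroup := {G of Topological G & Group G}.

Section Smooth.
Context {R : realType}.

(* Used for U open and V, W finite-dimensional, where it is the usual notion
   (all directional derivatives of f are C^k). *)
Fixpoint Ck (V W : normedModType R) (k : nat) (U : set V) (f : V -> W) : Prop :=
  if k is k'.+1 then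
    (forall x, U x -> differentiable f x) /\
    (forall v, Ck k' U (fun x => 'd f x v))
  else forall x, U x -> {for x, continuous f}.

Definition smooth_on (V W : normedModType R) (U : set V) (f : V -> W) : Prop :=
  forall k, Ck k U f.

End Smooth.

(* The values of [cmap] outside [cdom], and of [cinv] outside the image of
   [cdom], are irrelevant. *)
Record chart (M E : Type) : Type := Chart {
  cdom : set M;
  cmap : M -> E;
  cinv : E -> M
}.

Definition cimg (M E : Type) (c : chart M E) : set E := cmap c @` cdom c.

Definition prod_chart (M N E F : Type) (c : chart M E) (d : chart N F) :
    chart (M * N) (E * F) :=
  Chart (cdom c `*` cdom d)
        (fun z => (cmap c z.1, cmap d z.2))
        (fun w => (cinv c w.1, cinv d w.2)).

Section Manifold.
Context {R : realType}.

Definition is_chart (M : topologicalType) (E : normedModType R)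
    (c : chart M E) : Prop :=
  [/\ open (cdom c),
      open (cimg c),
      forall p, cdom c p -> cinv c (cmap c p) = p,
      forall p, cdom c p -> {for p, continuous (cmap c)} &
      forall x, cimg c x -> {for x, continuous (cinv c)}].

(* An atlas is given as a preferred chart X p around each point p (the atlas
   being the range of X).  The tangent space at p is then E itself, a tangent
   vector at p being represented by its coordinates in the chart X p. *)
Definition smooth_manifold (M : topologicalType) (E : normedModType R)
    (X : M -> chart M E) : Prop :=
  [/\ hausdorff_space M,
      @second_countable M,
      forall p, is_chart (X p) /\ cdom (X p) p &
      forall p q, smooth_on (cmap (X p) @` (cdom (X p) `&` cdom (X q)))
                            (cmap (X q) \o cinv (X p))].

Definition model_atlas (E : normedModType R) : E -> chart E E :=
  fun=> Chart setT id id.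

Definition prod_atlas (M N : topologicalType) (E F : normedModType R)
    (X : M -> chart M E) (Y : N -> chart N F) :
    M * N -> chart (M * N) (E * F) :=
  fun z => prod_chart (X z.1) (Y z.2).

(* U is always an open subset of M. *)
Definition smooth_map (M N : topologicalType) (E F : normedModType R)
    (X : M -> chart M E) (Y : N -> chart N F) (U : set M) (f : M -> N) : Prop :=
  (forall p, U p -> {for p, continuous f}) /\
  (forall p q, smooth_on
     (cmap (X p) @` (cdom (X p) `&` U `&` f @^-1` cdom (Y q)))
     (cmap (Y q) \o f \o cinv (X p))).

Definition tangent_map (M N : topologicalType) (E F : normedModType R)
    (X : M -> chart M E) (Y : N -> chart N F) (f : M -> N) (p : M) : E -> F :=
  'd (cmap (Y (f p)) \o f \o cinv (X p)) (cmap (X p) p).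

End Manifold.

Section LieGroup.
Context {R : realType} {n : nat} {G : topoGroupType}.
Variable X : G -> chart G 'rV[R]_n.

Definition lie_group : Prop :=
  [/\ smooth_manifold X,
      smooth_map (prod_atlas X X) X setT (fun z : G * G => (z.1 * z.2)%g) &
      smooth_map X X setT (fun x : G => x^-1%g)].

(* The Lie algebra of G is T_1 G, i.e. 'rV[R]_n through the chart X 1. *)
Definition Ad (a : G) : 'rV[R]_n -> 'rV[R]_n :=
  tangent_map X X (fun x : G => (a * x * a^-1)%g) 1%g.

(* [u, v] = ad u v, where ad is the differential at 1 of x |-> Ad x. *)
Definition lie_bracket (u v : 'rV[R]_n) : 'rV[R]_n :=
  tangent_map X (@model_atlas R 'rV[R]_n) (fun x : G => Ad x v) 1%g u.

Definition killing (u v : 'rV[R]_n) : R :=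
  \tr (lin1_mx (lie_bracket u \o lie_bracket v)).

Definition semisimple : Prop :=
  forall u, (forall v, killing u v = 0) -> u = 0.

Definition subgroup (H : set G) : Prop :=
  [/\ H 1%g, forall x y, H x -> H y -> H (x * y)%g & forall x, H x -> H x^-1%g].

Definition normalizer (H : set G) : set G :=
  [set g | [set (g * h * g^-1)%g | h in H] = H].

(* T_1 H inside T_1 G: velocities at 0 of the smooth curves of G through 1
   that lie in H (a closed subgroup is an embedded submanifold). *)
Definition lie_subalgebra (H : set G) : set 'rV[R]_n :=
  [set u | exists (U : set R) (c : R -> G),
     [/\ open_nbhs 0 U,
         smooth_map (@model_atlas R R) X U c,
         c 0 = 1%g,
         forall t, U t -> H (c t) &
         tangent_map (@model_atlas R R) X c 0 1 = u]].

Definition orthogonal_complement (H : set G) (m : {vspace 'rV[R]_n}) : Prop :=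
  forall v, v \in m <-> forall u, lie_subalgebra H u -> - killing u v = 0.

(* M, with projection proj : G -> M, is the manifold G/H: proj identifies M
   with the set of left cosets of H, is smooth, and has smooth local sections; these
   properties determine the topology and smooth structure of G/H. *)
Definition homogeneous_space (H : set G) (M : topologicalType) (d : nat)
    (XM : M -> chart M 'rV[R]_d) (proj : G -> M) : Prop :=
  [/\ smooth_manifold XM,
      forall p, exists a, proj a = p,
      forall a b, proj a = proj b <-> H (a^-1 * b)%g,
      smooth_map X XM setT proj &
      forall p, exists (U : set M) (s : M -> G),
        [/\ open_nbhs p U, smooth_map XM X U s & forall q, U q -> proj (s q) = q]].

End LieGroup.

Section InnerProduct.
Context {R : realType} {V : lmodType R}.

Definition inner_product (b : V -> V -> R) : Prop :=
  [/\ forall u v, b u v = b v u,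
      forall a u v w, b (a *: u + v) w = a * b u w + b v w &
      forall u, u != 0 -> 0 < b u u].

End InnerProduct.

Section Metric.
Context {R : realType}.

(* In the chart X p, the components g_ij of the metric are smooth: the
   differential of the change of charts expresses the constant vector field u
   of the chart X p, at the point q, in the chart X q that defines T_q M. *)
Definition riemannian_metric (M : topologicalType) (d : nat)
    (X : M -> chart M 'rV[R]_d) (g : M -> 'rV[R]_d -> 'rV[R]_d -> R) : Prop :=
  (forall p, inner_product (g p)) /\
  (forall p u v, smooth_on (cimg (X p))
     (fun x => let q := cinv (X p) x in
        let D := 'd (cmap (X q) \o cinv (X p)) x in
        (g q (D u) (D v) : R))).

Context {n d : nat} {G : topoGroupType} {M : topologicalType}.
Variables (X : G -> chart G 'rV[R]_n) (XM : M -> chart M 'rV[R]_d).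
Variable proj : G -> M.

(* a . (bH) = (ab)H, for any representative b. *)
Definition translation (a : G) (p : M) : M :=
  proj (a * xget 1%g (proj @^-1` [set p]))%g.

Definition isometry (g : M -> 'rV[R]_d -> 'rV[R]_d -> R) (f : M -> M) : Prop :=
  forall p u v,
    g (f p) (tangent_map XM XM f p u) (tangent_map XM XM f p v) = g p u v.

Definition invariant_metrics : set (M -> 'rV[R]_d -> 'rV[R]_d -> R) :=
  [set g | riemannian_metric XM g /\ forall a, isometry g (translation a)].

(* The restriction of g to T_o M, o = proj 1, transported to m by the
   differential of proj. *)
Definition metric_at_o (m : {vspace 'rV[R]_n})
    (g : M -> 'rV[R]_d -> 'rV[R]_d -> R) : subvs_of m -> subvs_of m -> R :=
  fun u v => g (proj 1%g) (tangent_map X XM proj 1%g (vsval u))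
                        (tangent_map X XM proj 1%g (vsval v)).

End Metric.

Section Operators.
Context {R : realType} {n : nat} {G : topoGroupType}.
Variables (X : G -> chart G 'rV[R]_n) (m : {vspace 'rV[R]_n}).

(* Ad(a) restricted to m, when Ad(a) maps m to m. *)
Definition Ad_m (a : G) : 'End(subvs_of m) :=
  linfun (vsproj m \o Ad X a \o vsval).

Definition Aut_m : set 'End(subvs_of m) := [set phi | bijective phi].

Definition neg_killing (u v : subvs_of m) : R :=
  - killing X (vsval u) (vsval v).

Definition metric_operators (H : set G) : set 'End(subvs_of m) :=
  [set A | [/\ forall h, H h -> (Ad_m h \o A = A \o Ad_m h)%VF,
               forall u v, neg_killing (A u) v = neg_killing u (A v) &
               forall u, u != 0 -> 0 < neg_killing (A u) u]].

Definition operator_product (A : 'End(subvs_of m)) :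
    subvs_of m -> subvs_of m -> R :=
  fun u v => neg_killing (A u) v.

Definition invariant_products (K : set G) : set (subvs_of m -> subvs_of m -> R) :=
  [set b | inner_product b /\
     forall k, K k -> forall u v, b (Ad_m k u) (Ad_m k v) = b u v].

Definition conj_operator (phi A : 'End(subvs_of m)) : 'End(subvs_of m) :=
  (phi \o A \o phi^-1)%VF.

Definition fixed_operators (H : set G) (P : set 'End(subvs_of m)) :
    set 'End(subvs_of m) :=
  [set A | metric_operators H A /\ forall phi, P phi -> conj_operator phi A = A].

Definition subgroup_of_Aut (P : set 'End(subvs_of m)) : Prop :=
  [/\ P `<=` Aut_m, P \1%VF,
      forall phi psi, P phi -> P psi -> P (phi \o psi)%VF &
      forall phi, P phi -> P (phi^-1)%VF].

Definition acts_on (P S : set 'End(subvs_of m))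
    (act : 'End(subvs_of m) -> 'End(subvs_of m) -> 'End(subvs_of m)) : Prop :=
  [/\ forall phi A, P phi -> S A -> S (act phi A),
      forall A, S A -> act \1%VF A = A &
      forall phi psi A, P phi -> P psi -> S A ->
        act (phi \o psi)%VF A = act phi (act psi A)].

End Operators.

Arguments Ad_m {R n G} X m a.
Arguments metric_at_o {R n d G M} X XM proj m g u v.
Arguments metric_operators {R n G} X m H.
Arguments operator_product {R n G} X m A u v.
Arguments invariant_products {R n G} X m K.
Arguments fixed_operators {R n G} X m H P.
Arguments conj_operator {R n m} phi A.

(* Main.v *)
From HB Require Import structures.
Require Import Defs.
From mathcomp Require Import all_boot all_order all_algebra.
From mathcomp Require Import all_classical all_reals all_analysis.
Import numFieldNormedType.Exports.
Import Order.TTheory GRing.Theory Num.Theory.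
Local Open Scope classical_set_scope.
Local Open Scope ring_scope.
Set Implicit Arguments.
Unset Strict Implicit.
Unset Printing Implicit Defensive.

(** Part (2) and the second identification are linear algebra once two facts
    are known: Ad(a), for a in N_G(H), preserves both m and -B, and -B is an inner
    product.  Indeed, for a subgroup S of N_G(H), the nondegenerate form -B turns an
    inner product on m into a symmetric positive operator A, and the product is
    Ad(S)-invariant exactly when A commutes with Ad(S) ([operator_product_bij]).
    Being fixed under conjugation by Ad(K) means commuting with Ad(K), so the case
    S = K of this correspondence is part (2) and the case S = H is the
    identification of the operators with the Ad(H)-invariant products.  Part (1)
    holds because K normalizes H.

    Ad(a) preserves B because it is the differential at 1 of an automorphism of G,
    hence an automorphism of the Lie algebra ([Ad_bracket]); it preserves the Lie
    algebra of H when a normalizes H, hence also the complement m.  That -B is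
    positive definite comes from compactness ([neg_killing_gt0]).  The group Ad(G) is
    bounded, so it preserves some inner product Q.  Here Q is obtained without a Haar
    measure: the largest Frobenius norm along the orbit of a form is a function with
    a unique minimum on a suitable closed convex invariant set of positive definite
    forms, and by uniqueness the minimum point is invariant
    ([bounded_group_invariant_form]).  Each ad u is skew for Q, so
    tr ((ad u)^2) < 0 unless ad u = 0, and ad u = 0 forces u = 0 by nondegeneracy.

    The identification of invariant metrics with inner products on m rests on the
    tangent space of G/H.  The kernel of the differential of the projection is the
    Lie algebra of H: a curve with velocity in the kernel is pushed into H by a local
    section, without changing its velocity ([ker_dproj]).  Hence the differential
    restricts to an isomorphism from m to the tangent space at the base point
    ([dprojm_inj], [dprojm_surj]).  An invariant metric is determined by its value
    there, because the translations act transitively; conversely an Ad(H)-invariant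
    product is spread over G/H by the translations, and the result is smooth because,
    with a local section s, the transported vectors are partial derivatives of the
    smooth function (x, y) |-> s(x)^-1 s(y) H ([invariant_metric_extension]).

    Smoothness is handled through parametrizations, that is, smooth maps from open
    subsets of normed spaces into a manifold: they are stable under composition with
    smooth maps and under the group operations, and together with the chain rule for
    [tangent_map] they give all the derivatives needed. *)

(** * Calculus of C^k maps between normed spaces *)

Section CkCalculus.
Context {R : realType}.
Implicit Types V W Z : normedModType R.

Lemma near_eq_differentiable V W (f g : V -> W) x :
  (\near x, f x = g x) -> differentiable f x ->
  differentiable g x /\ 'd g x = 'd f x :> (V -> W).
Proof.
move=> fg df.
have H : g \o shift x = cst (g x) + 'd f x +o_ 0 id.
  apply/eqaddoP => e e0.
  have [dfc /eqaddoP/(_ e e0)] := (iffLR (diff_locallyP _ _)) df.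
  apply: filter_app.
  have fg0 : \forall h \near 0, f (h + x) = g (h + x).
    by move: fg; rewrite (near_shift 0)/= subr0.
  near=> h => /=.
  rewrite /= /cst !fctE /= -(nbhs_singleton fg).
  by rewrite (_ : f (h + x) = g (h + x))//; near: h.
have E : 'd g x = 'd f x :> (V -> W).
  by apply: diff_unique => //; apply: diff_continuous.
split=> //; apply/diff_locallyP; rewrite E; split=> //.
exact: diff_continuous.
Unshelve. all: by end_near. Qed.

Lemma near_eq_diff V W (f g : V -> W) x :
  (\near x, f x = g x) -> differentiable f x ->
  'd g x = 'd f x :> (V -> W).
Proof. by move=> fg /(near_eq_differentiable fg)[]. Qed.

(** Membership in C^k is a condition at each point, so it can be checked on
    the pieces of any covering of the domain. *)
Lemma Ck_local V W k (U : set V) (f : V -> W) :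
  (forall x, U x -> exists2 U', U' x & Ck k U' f) -> Ck k U f.
Proof.
elim: k f => [|k IH] f Uf /=.
  by move=> x /Uf[U' U'x]; apply.
split=> [x /Uf[U' U'x []]|v]; first by move=> + _; apply.
by apply: IH => x /Uf[U' U'x [_ /(_ v)]]; exists U'.
Qed.

Lemma Ck_sub V W k (U U' : set V) (f : V -> W) :
  U `<=` U' -> Ck k U' f -> Ck k U f.
Proof. by move=> UU' fk; apply: Ck_local => x /UU' U'x; exists U'. Qed.

Lemma smooth_on_sub V W (U U' : set V) (f : V -> W) :
  U `<=` U' -> smooth_on U' f -> smooth_on U f.
Proof. by move=> UU' fk k; apply: Ck_sub UU' _. Qed.

Lemma smooth_on_local V W (U : set V) (f : V -> W) :
  (forall x, U x -> exists2 U', U' x & smooth_on U' f) -> smooth_on U f.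
Proof.
by move=> Uf k; apply: Ck_local => x /Uf[U' U'x fs]; exists U'.
Qed.

Lemma Ck_ext V W k (U : set V) (f g : V -> W) : open U ->
  (forall x, U x -> f x = g x) -> Ck k U f -> Ck k U g.
Proof.
move=> oU; elim: k f g => [|k IH] f g fg /=.
  move=> fc x Ux; rewrite /prop_for /continuous_at -(fg x Ux).
  apply: cvg_trans (fc x Ux); apply: near_eq_cvg.
  by near=> y; apply: fg; near: y; apply: open_nbhs_nbhs.
have nfg x : U x -> \near x, f x = g x.
  by move=> Ux; near=> y; apply: fg; near: y; apply: open_nbhs_nbhs.
move=> [fd fk]; split=> [x Ux|v].
  by have [] := near_eq_differentiable (nfg x Ux) (fd x Ux).
apply: IH (fk v) => x Ux.
by rewrite (near_eq_diff (nfg x Ux) (fd x Ux)).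
Unshelve. all: by end_near. Qed.

Lemma smooth_on_ext V W (U : set V) (f g : V -> W) : open U ->
  (forall x, U x -> f x = g x) -> smooth_on U f -> smooth_on U g.
Proof. by move=> oU fg fs k; apply: Ck_ext oU fg (fs k). Qed.

Lemma CkS V W k (U : set V) (f : V -> W) : Ck k.+1 U f -> Ck k U f.
Proof.
elim: k f => [|k IH] f [fd fk]; last by split=> // v; apply: IH.
by move=> x /fd; apply: differentiable_continuous.
Qed.

Lemma Ck_cst V W k (U : set V) (w : W) : Ck k U (cst w : V -> W).
Proof.
elim: k w => [|k IH] w /=; first by move=> x _; apply: cst_continuous.
split=> [x _|v]; first exact: differentiable_cst.
by under eq_fun do rewrite diff_cst; apply: IH.
Qed.

Lemma Ck_linear V W k (U : set V) (f : {linear V -> W}) :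
  continuous f -> Ck k U f.
Proof.
case: k => [|k] fc /=; first by move=> x _; apply: fc.
split=> [x _|v]; first exact: linear_differentiable.
under eq_fun do rewrite diff_lin//.
exact: Ck_cst.
Qed.

Lemma Ck_linear_comp V W Z k (U : set V) (f : V -> W) (l : {linear W -> Z}) :
  open U -> continuous l -> Ck k U f -> Ck k U (l \o f).
Proof.
move=> oU lc; elim: k f => [|k IH] f /=.
  by move=> fc x Ux; apply: continuous_comp; [apply: fc|apply: lc].
move=> [fd fk]; split=> [x Ux|v].
  by apply: differentiable_comp; [apply: fd|apply: linear_differentiable].
apply: Ck_ext (IH _ (fk v)) => // x Ux.
rewrite diff_comp//; first by rewrite /= diff_lin.
  exact: fd.
exact: linear_differentiable.
Qed.

Lemma Ck_add V W k (U : set V) (f g : V -> W) :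
  open U -> Ck k U f -> Ck k U g -> Ck k U (f + g).
Proof.
move=> oU; elim: k f g => [|k IH] f g /=.
  by move=> fc gc x Ux; apply: continuousD; [apply: fc|apply: gc].
move=> [fd fk] [gd gk]; split=> [x Ux|v].
  by apply: differentiableD; [apply: fd|apply: gd].
apply: Ck_ext (IH _ _ (fk v) (gk v)) => // x Ux.
by rewrite diffD//; [apply: fd|apply: gd].
Qed.

Lemma Ck_sum V W k (U : set V) n (f : 'I_n -> V -> W) :
  open U -> (forall i, Ck k U (f i)) -> Ck k U (fun x => \sum_i f i x).
Proof.
move=> oU; elim: n f => [|n IH] f fk.
  by under eq_fun do rewrite big_ord0; apply: Ck_cst.
under eq_fun do rewrite big_ord_recl; apply: Ck_add => //.
exact: IH.
Qed.

(** Scalar multiplication as a map of two arguments, so that the product rule is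
    the derivative of a bilinear map. *)
Definition scaling W (a : R) (w : W) : W := a *: w.

Lemma scaling_is_bilinear W :
  bilinear_for
    (GRing.Scale.Law.clone _ _ *:%R _) (GRing.Scale.Law.clone _ _ *:%R _)
    (@scaling W).
Proof.
split=> [u'|u] a x y; rewrite /scaling/=.
- by rewrite scalerDl scalerA.
- by rewrite scalerDr !scalerA mulrC.
Qed.

HB.instance Definition _ W := bilinear_isBilinear.Build R R W W _ _
  (@scaling W) (@scaling_is_bilinear W).

Lemma is_diff_scale V W (a : V -> R) (f : V -> W) x :
  differentiable a x -> differentiable f x ->
  differentiable (fun y => a y *: f y) x /\
  'd (fun y => a y *: f y) x =
    (fun v => a x *: 'd f x v + 'd a x v *: f x) :> (V -> W).
Proof.
move=> da df.
have sc : continuous (fun p : R * W => scaling p.1 p.2).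
  by move=> p; apply: (@scale_continuous R W p).
have -> : (fun y => a y *: f y) =
    (fun p : R * W => scaling p.1 p.2) \o (fun y => (a y, f y)) by [].
have dp := differentiable_pair da df.
have ds := differentiable_bilin (a x, f x) sc.
split; first exact: differentiable_comp.
by rewrite diff_comp// diff_pair// diff_bilin.
Qed.

Lemma Ck_scale V W k (U : set V) (a : V -> R) (f : V -> W) : open U ->
  Ck k U a -> Ck k U f -> Ck k U (fun x => a x *: f x).
Proof.
move=> oU; elim: k a f => [|k IH] a f /=.
  move=> ac fc x Ux.
  by apply: continuousZ; [apply: ac|apply: fc].
move=> [ad ak] [fd fk]; split=> [x Ux|v].
  by have [] := is_diff_scale (ad x Ux) (fd x Ux).
have aS : Ck k U a by apply: CkS.
have fS : Ck k U f by apply: CkS.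
apply: Ck_ext (Ck_add oU (IH _ _ aS (fk v)) (IH _ _ (ak v) fS)) => // x Ux.
by have [_ ->] := is_diff_scale (ad x Ux) (fd x Ux).
Qed.

Lemma Ck_pair V W Z k (U : set V) (f : V -> W) (g : V -> Z) : open U ->
  Ck k U f -> Ck k U g -> Ck k U (fun x => (f x, g x)).
Proof.
move=> oU; elim: k f g => [|k IH] f g /=.
  by move=> fc gc x Ux; apply: cvg_pair; [apply: fc|apply: gc].
move=> [fd fk] [gd gk]; split=> [x Ux|v].
  by apply: differentiable_pair; [apply: fd|apply: gd].
apply: Ck_ext (IH _ _ (fk v) (gk v)) => // x Ux.
by rewrite diff_pair//; [apply: fd|apply: gd].
Qed.

(** Finite dimension of a normed space, in the only form used: continuous
    linear coordinates on a finite family. *)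
Definition fin_dim V := exists n (e : 'I_n -> V) (c : 'I_n -> {linear V -> R}),
  (forall i, continuous (c i)) /\ forall v, v = \sum_i c i v *: e i.

(** The chain rule reads 'd (g \o f) x v = 'd g (f x) ('d f x v); expanding the
    inner vector in coordinates turns the right-hand side into a sum of products
    of functions which are C^k by induction. *)
Lemma Ck_comp V W Z k (U : set V) (U' : set W) (f : V -> W) (g : W -> Z) :
  fin_dim W -> open U -> (forall x, U x -> U' (f x)) ->
  Ck k U f -> Ck k U' g -> Ck k U (g \o f).
Proof.
move=> [n [e [c [cc ce]]]] oU UU'; elim: k f g UU' => [|k IH] f g UU'.
  move=> fc gc x Ux.
  by apply: continuous_comp; [apply: fc|apply: gc; apply: UU'].
move=> fS; have fk := CkS fS; case: fS => fd f1 [gd g1].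
split=> [x Ux|v].
  by apply: differentiable_comp; [apply: fd|apply/gd/UU'].
apply: (@Ck_ext _ _ k U
  (fun x => \sum_i c i ('d f x v) *: ('d g (f x) (e i)))) => //.
  move=> x Ux; rewrite (diff_comp (fd x Ux) (gd _ (UU' x Ux))).
  rewrite /= [in RHS](ce ('d f x v)) linear_sum.
  by apply: eq_bigr => i _; rewrite linearZ.
apply: Ck_sum => // i; apply: Ck_scale => //.
  exact: (@Ck_linear_comp _ _ _ k U (fun x => 'd f x v) (c i) oU (cc i) (f1 v)).
exact: (IH f (fun y => 'd g y (e i)) UU' fk (g1 _)).
Qed.

Lemma smooth_on_comp V W Z (U : set V) (U' : set W) (f : V -> W) (g : W -> Z) :
  fin_dim W -> open U -> (forall x, U x -> U' (f x)) ->
  smooth_on U f -> smooth_on U' g -> smooth_on U (g \o f).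
Proof. by move=> dW oU UU' fs gs k; apply: Ck_comp (gs k). Qed.

Lemma smooth_on_pair V W Z (U : set V) (f : V -> W) (g : V -> Z) : open U ->
  smooth_on U f -> smooth_on U g -> smooth_on U (fun x => (f x, g x)).
Proof. by move=> oU fs gs k; apply: Ck_pair. Qed.

Lemma smooth_on_diff V W (U : set V) (f : V -> W) v :
  smooth_on U f -> smooth_on U (fun x => 'd f x v).
Proof. by move=> fs k; have [_ fk] := fs k.+1; exact: (fk v). Qed.

Lemma smooth_on_differentiable V W (U : set V) (f : V -> W) x :
  smooth_on U f -> U x -> differentiable f x.
Proof. by move=> /(_ 1%N)[+ _]; apply. Qed.

Lemma smooth_on_linear V W (U : set V) (f : {linear V -> W}) :
  continuous f -> smooth_on U f.
Proof. by move=> fc k; apply: Ck_linear. Qed.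

End CkCalculus.

Section FiniteDimension.
Context {R : realType}.

Lemma fin_dim_rV n : fin_dim ('rV[R]_n : normedModType R).
Proof.
have cl (i : 'I_n) : linear (fun v : 'rV[R]_n => v 0 i).
  by move=> a u v; rewrite !mxE.
pose c i : {linear 'rV[R]_n -> R} :=
  HB.pack (fun v : 'rV[R]_n => v 0 i) (GRing.isLinear.Build _ _ _ _ _ (cl i)).
exists n, (fun i => delta_mx 0 i), c; split=> [i v|v].
  exact: coord_continuous.
exact: row_sum_delta.
Qed.

Lemma fin_dim_prod (V W : normedModType R) :
  fin_dim V -> fin_dim W -> fin_dim (V * W)%type.
Proof.
move=> [n [e [c [cc ce]]]] [p [e' [c' [cc' ce']]]].
pose E (i : 'I_(n + p)) : V * W :=
  match fintype.split i with inl j => (e j, 0) | inr j => (0, e' j) end.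
pose C0 (i : 'I_(n + p)) (z : V * W) : R :=
  match fintype.split i with inl j => c j z.1 | inr j => c' j z.2 end.
have Cl i : linear (C0 i).
  by move=> a u v; rewrite /C0; case: (fintype.split i) => j; rewrite linearP.
pose C i : {linear (V * W)%type -> R} :=
  HB.pack (C0 i) (GRing.isLinear.Build _ _ _ _ _ (Cl i)).
exists (n + p)%N, E, C; split=> [i z|[v w]].
  rewrite /C /C0/=; case: (fintype.split i) => j.
    by apply: continuous_comp; [exact: cvg_fst|exact: cc].
  by apply: continuous_comp; [exact: cvg_snd|exact: cc'].
rewrite big_split_ord/= /C0 /E/=.
under eq_bigr do rewrite (unsplitK (inl _)).
under [X in _ + X]eq_bigr do rewrite (unsplitK (inr _)).
have sumE1 : \sum_i c i v *: (e i, 0 : W) = (v, 0).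
  rewrite [in RHS](ce v); elim/big_ind2 : _ => //=.
    by move=> a ? b ? -> ->; apply/pair_equal_spec; split=> //=; rewrite addr0.
  by move=> i _; apply/pair_equal_spec; split=> //=; rewrite scaler0.
have sumE2 : \sum_i c' i w *: (0 : V, e' i) = (0, w).
  rewrite [in RHS](ce' w); elim/big_ind2 : _ => //=.
    by move=> a ? b ? -> ->; apply/pair_equal_spec; split=> //=; rewrite addr0.
  by move=> i _; apply/pair_equal_spec; split=> //=; rewrite scaler0.
by rewrite sumE1 sumE2; apply/pair_equal_spec; rewrite /= addr0 add0r.
Qed.

Lemma rV_linear_continuous n (W : normedModType R) (f : {linear 'rV[R]_n -> W}) :
  continuous f.
Proof.
have -> : (f : 'rV[R]_n -> W) =
    fun v => \sum_i (v 0 i) *: f (delta_mx 0 i).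
  apply/funext => v; rewrite [in LHS](row_sum_delta v) linear_sum.
  by apply: eq_bigr => i _; rewrite linearZ.
suff : Ck 0 setT (fun v : 'rV[R]_n => \sum_i (v 0 i) *: f (delta_mx 0 i)).
  by move=> H v; apply: H.
apply: Ck_sum => [|i]; first exact: openT.
apply: Ck_scale => [||]; [exact: openT| |exact: Ck_cst].
by move=> v _; apply: coord_continuous.
Qed.

Section Form.
Context {n p : nat} (b : 'rV[R]_n -> 'rV[R]_p -> R).
Hypotheses (b_linl : forall w, linear (b^~ w)) (b_linr : forall v, linear (b v)).

(** The expansion in coordinates, which reduces the regularity of b (f x) (g x) to
    that of sums and products of scalar functions. *)
Lemma form_sum (v : 'rV[R]_n) (w : 'rV[R]_p) :
  b v w = \sum_i \sum_j v 0 i *: (w 0 j *: b (delta_mx 0 i) (delta_mx 0 j)).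
Proof.
pose L w : {linear 'rV[R]_n -> R} :=
  HB.pack (b^~ w) (GRing.isLinear.Build _ _ _ _ _ (b_linl w)).
pose L' v : {linear 'rV[R]_p -> R} :=
  HB.pack (b v) (GRing.isLinear.Build _ _ _ _ _ (b_linr v)).
rewrite -[LHS]/(L w v) [in LHS](row_sum_delta v) linear_sum.
apply: eq_bigr => i _; rewrite linearZ -scaler_sumr; congr (_ *: _).
rewrite -[LHS]/(L' (delta_mx 0 i) w) [in LHS](row_sum_delta w) linear_sum.
by apply: eq_bigr => j _; rewrite linearZ.
Qed.

Lemma Ck_form (V : normedModType R) k (U : set V) (f : V -> 'rV[R]_n)
    (g : V -> 'rV[R]_p) : open U ->
  Ck k U f -> Ck k U g -> Ck k U (fun x => b (f x) (g x)).
Proof.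
move=> oU fk gk; under eq_fun do rewrite form_sum.
have coord m (h : V -> 'rV[R]_m) i : Ck k U h -> Ck k U (fun x => h x 0 i).
  have cl : linear (fun v : 'rV[R]_m => v 0 i) by move=> a u v; rewrite !mxE.
  pose c : {linear 'rV[R]_m -> R} :=
    HB.pack (fun v : 'rV[R]_m => v 0 i) (GRing.isLinear.Build _ _ _ _ _ cl).
  by move=> hk; apply: (@Ck_linear_comp _ _ _ _ k U h c oU) => // v;
    apply: coord_continuous.
apply: Ck_sum => // i; apply: Ck_sum => // j.
apply: Ck_scale => //; first exact: coord.
by apply: Ck_scale => //; [exact: coord|exact: Ck_cst].
Qed.

Lemma diff_form (V : normedModType R) (f : V -> 'rV[R]_n) (g : V -> 'rV[R]_p) x v :
  differentiable f x -> differentiable g x ->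
  'd (fun y => b (f y) (g y)) x v = b (f x) ('d g x v) + b ('d f x v) (g x).
Proof.
move=> df dg.
have bP : bilinear_for
    (GRing.Scale.Law.clone _ _ *:%R _) (GRing.Scale.Law.clone _ _ *:%R _) b.
  by split=> [w|u] a y z /=; [apply: b_linl|apply: b_linr].
pose B : {bilinear 'rV[R]_n -> 'rV[R]_p -> R} :=
  HB.pack b (bilinear_isBilinear.Build R _ _ _ _ _ b bP).
have Bc : continuous (fun z : 'rV[R]_n * 'rV[R]_p => B z.1 z.2).
  have Cf : Ck 0 [set: 'rV[R]_n * 'rV[R]_p] fst.
    by move=> y _; apply: cvg_fst.
  have Cs : Ck 0 [set: 'rV[R]_n * 'rV[R]_p] snd.
    by move=> y _; apply: cvg_snd.
  have Cb := Ck_form openT Cf Cs.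
  by move=> z; apply: (Cb z I).
have -> : (fun y => b (f y) (g y)) =
    (fun z : 'rV[R]_n * 'rV[R]_p => B z.1 z.2) \o (fun y => (f y, g y)) by [].
have dp := differentiable_pair df dg.
have dB := differentiable_bilin (f x, g x) Bc.
by rewrite diff_comp// diff_pair// diff_bilin.
Qed.

Lemma smooth_on_form (V : normedModType R) (U : set V) (f : V -> 'rV[R]_n)
    (g : V -> 'rV[R]_p) : open U ->
  smooth_on U f -> smooth_on U g -> smooth_on U (fun x => b (f x) (g x)).
Proof. by move=> oU fs gs k; apply: Ck_form. Qed.

End Form.

End FiniteDimension.

(** * Charts, smooth parametrizations and tangent maps *)

Section Charts.
Context {R : realType}.
Implicit Types E F : normedModType R.

Definition charted (M : topologicalType) E (X : M -> chart M E) :=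
  forall p, is_chart (X p) /\ cdom (X p) p.

Lemma open_preimage_on (S T : topologicalType) (U : set S) (B : set T)
    (f : S -> T) : open U -> open B -> (forall x, U x -> {for x, continuous f}) ->
  open (U `&` f @^-1` B).
Proof.
rewrite !openE => oU oB fc x [Ux fBx]; apply: filterI; first exact: oU.
by apply: (fc x Ux); apply: oB.
Qed.

Lemma open_setX (S T : topologicalType) (A : set S) (B : set T) :
  open A -> open B -> open (A `*` B).
Proof.
rewrite !openE => oA oB [x y] [/= Ax By].
by exists (A, B) => //; split; [apply: oA|apply: oB].
Qed.

Lemma continuous_prod_map (S T S' T' : topologicalType) (f : S -> S')
    (g : T -> T') z : {for z.1, continuous f} -> {for z.2, continuous g} ->
  {for z, continuous (fun w : S * T => (f w.1, g w.2))}.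
Proof.
move=> fc gc; apply: cvg_pair.
  by apply: (@continuous_comp _ _ _ fst f z) => //; apply: cvg_fst.
by apply: (@continuous_comp _ _ _ snd g z) => //; apply: cvg_snd.
Qed.

Section Chart.
Context {M : topologicalType} {E : normedModType R} {X : M -> chart M E}.
Hypothesis cX : charted X.

Lemma cinvK p q : cdom (X p) q -> cinv (X p) (cmap (X p) q) = q.
Proof. by have [[_ _ + _ _] _] := cX p; apply. Qed.

Lemma cmapK p x : cimg (X p) x -> cmap (X p) (cinv (X p) x) = x.
Proof. by case=> q pq <-; rewrite cinvK. Qed.

Lemma cinv_dom p x : cimg (X p) x -> cdom (X p) (cinv (X p) x).
Proof. by case=> q pq <-; rewrite cinvK. Qed.

Lemma cdom_open p : open (cdom (X p)). Proof. by have [[]] := cX p. Qed.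

Lemma cimg_open p : open (cimg (X p)). Proof. by have [[]] := cX p. Qed.

Lemma cdom_center p : cdom (X p) p. Proof. by have [] := cX p. Qed.

Lemma cimg_cmap p q : cdom (X p) q -> cimg (X p) (cmap (X p) q).
Proof. by exists q. Qed.

Lemma cimg_center p : cimg (X p) (cmap (X p) p).
Proof. exact/cimg_cmap/cdom_center. Qed.

Lemma cmap_continuous p q : cdom (X p) q -> {for q, continuous (cmap (X p))}.
Proof. by have [[_ _ _ + _] _] := cX p; apply. Qed.

Lemma cinv_continuous p x : cimg (X p) x -> {for x, continuous (cinv (X p))}.
Proof. by have [[_ _ _ _ +] _] := cX p; apply. Qed.

Lemma near_cdom p : \forall q \near p, cdom (X p) q.
Proof.
by apply: open_nbhs_nbhs; split; [apply: cdom_open|apply: cdom_center].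
Qed.

Lemma near_cimg p : \forall x \near cmap (X p) p, cimg (X p) x.
Proof.
by apply: open_nbhs_nbhs; split; [apply: cimg_open|apply: cimg_center].
Qed.

End Chart.

Lemma charted_model E : charted (@model_atlas R E).
Proof.
move=> p; split=> //; split=> //=; first exact: openT.
- by rewrite /cimg/= image_id; exact: openT.
- by move=> x _; apply: cvg_id.
- by move=> x _; apply: cvg_id.
Qed.

Lemma smooth_manifold_charted (M : topologicalType) E (X : M -> chart M E) :
  smooth_manifold X -> charted X.
Proof. by case. Qed.

Lemma charted_prod (M N : topologicalType) E F (X : M -> chart M E)
    (Y : N -> chart N F) : charted X -> charted Y -> charted (prod_atlas X Y).
Proof.
move=> cX cY [p q]; split; last by split; apply: cdom_center.
have imgE : cimg (prod_chart (X p) (Y q)) = cimg (X p) `*` cimg (Y q).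
  apply/seteqP; split=> [_ [[a b] [/= pa qb] <-]|[_ _] /= [[a pa <-] [b qb <-]]].
    by split; apply: cimg_cmap.
  by exists (a, b).
split=> /=.
- by apply: open_setX; apply: cdom_open.
- by rewrite /prod_atlas imgE; apply: open_setX; apply: cimg_open.
- by move=> [a b] [/= pa qb]; rewrite /= !cinvK.
- by move=> z [/= pa qb]; apply: continuous_prod_map; apply: cmap_continuous.
- rewrite /prod_atlas imgE => z [/= pa qb].
  by apply: continuous_prod_map; apply: cinv_continuous.
Qed.

(** A smooth map out of an open subset of a normed space.  Smoothness of maps
    between manifolds is used only through its effect on such
    parametrizations. *)
Definition param (M : topologicalType) E F (X : M -> chart M E) (U : set F)
  (f : F -> M) := smooth_map (@model_atlas R F) X U f.

Section Param.
Context {M : topologicalType} {E : normedModType R} {X : M -> chart M E}.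

Lemma paramP F (U : set F) (f : F -> M) :
  param X U f <-> (forall x, U x -> {for x, continuous f}) /\
    forall q, smooth_on (U `&` f @^-1` cdom (X q)) (cmap (X q) \o f).
Proof.
split=> -[fc fs]; split=> //.
  by move=> q; have := fs 0 q; rewrite /= image_id setTI.
by move=> p q; rewrite /= image_id setTI; apply: fs.
Qed.

Lemma param_smooth_on F (U : set F) (f : F -> M) q : param X U f ->
  (forall x, U x -> cdom (X q) (f x)) -> smooth_on U (cmap (X q) \o f).
Proof.
move=> /paramP[_ /(_ q) fs] Uq; apply: smooth_on_sub fs => x Ux.
by split=> //; apply: Uq.
Qed.

Lemma param_sub F (U V : set F) (f : F -> M) :
  V `<=` U -> param X U f -> param X V f.
Proof.
move=> VU /paramP[fc fs]; apply/paramP; split=> [x /VU|q]; first exact: fc.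
by apply: smooth_on_sub (fs q) => x [/VU].
Qed.

Lemma param_cst F (U : set F) a : param X U (cst a).
Proof.
apply/paramP; split=> [x _|q k]; first exact: cst_continuous.
exact: (@Ck_cst _ _ _ _ _ (cmap (X q) a)).
Qed.

Lemma param_cinv p : smooth_manifold X -> param X (cimg (X p)) (cinv (X p)).
Proof.
move=> sX; have cX := smooth_manifold_charted sX; case: sX => _ _ _ sX.
apply/paramP; split=> [x|q]; first exact: cinv_continuous.
apply: smooth_on_sub (sX p q) => x [px qx]; exists (cinv (X p) x).
  by split=> //; apply: cinv_dom.
exact: cmapK.
Qed.

Lemma param_precomp F F' (U : set F) (V : set F') (f : F' -> M) (l : F -> F') :
  charted X -> fin_dim F' -> open U -> (forall x, U x -> V (l x)) ->
  smooth_on U l -> param X V f -> param X U (f \o l).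
Proof.
move=> cX dF oU UV ls /paramP[fc fs].
have lc x : U x -> {for x, continuous l} by move: x; apply: (ls 0%N).
have flc x : U x -> {for x, continuous (f \o l)}.
  by move=> Ux; apply: continuous_comp; [apply: lc|apply/fc/UV].
apply/paramP; split=> // q.
have oUq : open (U `&` (f \o l) @^-1` cdom (X q)).
  by apply: open_preimage_on => //; apply: cdom_open.
apply: (smooth_on_comp dF oUq _ _ (fs q)).
  by move=> x [Ux qx]; split=> //; apply: UV.
by apply: smooth_on_sub ls => x [].
Qed.

End Param.

Section ParamComp.
Context {M N : topologicalType} {E F : normedModType R}.
Context {X : M -> chart M E} {Y : N -> chart N F}.
Hypotheses (cX : charted X) (cY : charted Y).

Lemma param_comp (D : normedModType R) (U : set D) (V : set M) (phi : D -> M)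
    (f : M -> N) :
  fin_dim E -> open U -> open V -> (forall x, U x -> V (phi x)) ->
  param X U phi -> smooth_map X Y V f -> param Y U (f \o phi).
Proof.
move=> dE oU oV UV /paramP[pc ps] [fc fs].
have fpc x : U x -> {for x, continuous (f \o phi)}.
  by move=> Ux; apply: continuous_comp; [apply: pc|apply/fc/UV].
apply/paramP; split=> // q; apply: smooth_on_local => x [Ux qx].
set p := phi x.
have oU1 : open (U `&` phi @^-1` cdom (X p)).
  by apply: open_preimage_on => //; apply: cdom_open.
have oU' : open (U `&` phi @^-1` cdom (X p) `&` (f \o phi) @^-1` cdom (Y q)).
  apply: open_preimage_on => //; first exact: cdom_open.
  by move=> y [Uy _]; apply: fpc.
exists (U `&` phi @^-1` cdom (X p) `&` (f \o phi) @^-1` cdom (Y q)).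
  by split=> //; split=> //; apply: cdom_center.
apply: (@smooth_on_ext _ _ _ _
  ((cmap (Y q) \o f \o cinv (X p)) \o (cmap (X p) \o phi))) => //.
  by move=> y [[Uy py] qy] /=; rewrite cinvK.
apply: (smooth_on_comp dE oU' _ _ (fs p q)).
  move=> y [[Uy py] qy]; exists (phi y) => //; split=> //; split=> //.
  exact: UV.
by apply: smooth_on_sub (ps p) => y [].
Qed.

Lemma param_pair (D : normedModType R) (U : set D) (f : D -> M) (g : D -> N) :
  open U -> param X U f -> param Y U g ->
  param (prod_atlas X Y) U (fun x => (f x, g x)).
Proof.
move=> oU /paramP[fc fs] /paramP[gc gs].
have fgc x : U x -> {for x, continuous (fun x => (f x, g x))}.
  by move=> Ux; apply: cvg_pair; [apply: fc|apply: gc].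
apply/paramP; split=> // -[p q].
have oU' : open (U `&` (fun x => (f x, g x)) @^-1` cdom (prod_atlas X Y (p, q))).
  by apply: open_preimage_on => //; apply/cdom_open/charted_prod.
apply: smooth_on_pair => //.
  by apply: smooth_on_sub (fs p) => x [Ux []].
by apply: smooth_on_sub (gs q) => x [Ux []].
Qed.

End ParamComp.

(** Differentiability at one point, read in the preferred charts.  It is the
    hypothesis under which [tangent_map] obeys the chain rule. *)
Definition mdiff (M N : topologicalType) E F (X : M -> chart M E)
    (Y : N -> chart N F) (f : M -> N) (p : M) :=
  {for p, continuous f} /\
  differentiable (cmap (Y (f p)) \o f \o cinv (X p)) (cmap (X p) p).

Lemma mdiff_smooth (M N : topologicalType) E F (X : M -> chart M E)
    (Y : N -> chart N F) (U : set M) (f : M -> N) (p : M) :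
  charted X -> charted Y -> smooth_map X Y U f -> U p -> mdiff X Y f p.
Proof.
move=> cX cY [fc fs] Up; split; first exact: fc.
apply: (smooth_on_differentiable (fs p (f p))); exists p => //.
by split; [split=> //; apply: cdom_center|apply: cdom_center].
Qed.

Lemma near_cinv (M : topologicalType) E (X : M -> chart M E) (P : set M) p :
  charted X -> (\near p, P p) -> \forall x \near cmap (X p) p, P (cinv (X p) x).
Proof.
move=> cX; have /(_ P) := cinv_continuous cX (cimg_center cX p).
by rewrite cinvK//; apply: cdom_center.
Qed.

Section Tangent.
Context {M N : topologicalType} {E F : normedModType R}.
Context {X : M -> chart M E} {Y : N -> chart N F}.
Hypotheses (cX : charted X) (cY : charted Y).

Lemma tangent_linear (f : M -> N) p : linear (tangent_map X Y f p).
Proof. by move=> a u v; rewrite /tangent_map linearP. Qed.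

Lemma mdiff_near (f g : M -> N) p :
  (\near p, f p = g p) -> mdiff X Y f p -> mdiff X Y g p.
Proof.
move=> fg [fc fd]; have fgp := nbhs_singleton fg; split.
  rewrite /prop_for /continuous_at -fgp.
  by apply: cvg_trans fc; apply: near_eq_cvg.
rewrite -fgp.
have /near_eq_differentiable/(_ fd)[]// : \forall x \near cmap (X p) p,
    (cmap (Y (f p)) \o f \o cinv (X p)) x = (cmap (Y (f p)) \o g \o cinv (X p)) x.
apply: filterS (near_cinv cX fg) => x /= ->.
by [].
Qed.

Lemma tangent_near (f g : M -> N) p : (\near p, f p = g p) ->
  mdiff X Y f p -> tangent_map X Y g p = tangent_map X Y f p.
Proof.
move=> fg [fc fd]; have fgp := nbhs_singleton fg.
rewrite /tangent_map -fgp; apply: near_eq_diff => //.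
by apply: filterS (near_cinv cX fg) => x /= ->.
Qed.

(** The means of proving differentiability on a group: after composition with an
    inverse chart, translations and conjugations are products of
    parametrizations. *)
Lemma mdiff_param (U : set E) (f : M -> N) p :
  U (cmap (X p) p) -> param Y U (f \o cinv (X p)) -> mdiff X Y f p.
Proof.
move=> Up /paramP[fc fs]; have pp := cdom_center cX p.
split; last first.
  by apply: (smooth_on_differentiable (fs (f p))); split=> //=; rewrite cinvK//;
    apply: cdom_center.
have fpc : {for p, continuous ((f \o cinv (X p)) \o cmap (X p))}.
  by apply: continuous_comp; [apply: cmap_continuous|apply: fc].
have fE : \forall q \near p, ((f \o cinv (X p)) \o cmap (X p)) q = f q.
  by apply: filterS (near_cdom cX p) => q pq /=; rewrite cinvK.
rewrite /prop_for /continuous_at -(nbhs_singleton fE).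
by apply: cvg_trans fpc; apply: near_eq_cvg.
Qed.

Lemma tangent_cst (b : N) p : mdiff X Y (cst b) p /\
  forall u, tangent_map X Y (cst b) p u = 0.
Proof.
split; first split; first exact: cst_continuous.
  exact: (differentiable_cst (cmap (Y b) b)).
move=> u; rewrite /tangent_map.
by rewrite (_ : _ \o _ = cst (cmap (Y b) b))// diff_cst.
Qed.

Lemma tangent_id p : mdiff X X id p /\ forall u, tangent_map X X id p u = u.
Proof.
have idE : \forall x \near cmap (X p) p, x = (cmap (X p) \o id \o cinv (X p)) x.
  by apply: filterS (near_cimg cX p) => x px /=; rewrite cmapK.
have did : differentiable (id : E -> E) (cmap (X p) p) by [].
have [? dE] := near_eq_differentiable idE did.
split; first by split=> //; apply: cvg_id.
by move=> u; rewrite /tangent_map dE diff_val.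
Qed.

End Tangent.

Section TangentComp.
Context {M N P : topologicalType} {E F D : normedModType R}.
Context {X : M -> chart M E} {Y : N -> chart N F} {Z : P -> chart P D}.
Hypotheses (cX : charted X) (cY : charted Y).

Lemma tangent_comp (f : M -> N) (g : N -> P) p :
  mdiff X Y f p -> mdiff Y Z g (f p) -> mdiff X Z (g \o f) p /\
  forall u, tangent_map X Z (g \o f) p u =
            tangent_map Y Z g (f p) (tangent_map X Y f p u).
Proof.
move=> [fc fd] [gc gd]; have pp := cdom_center cX p.
have cf : \forall x \near cmap (X p) p, cdom (Y (f p)) (f (cinv (X p) x)).
  apply: (near_cinv (P := fun q => cdom (Y (f p)) (f q))) => //.
  by apply: (fc (cdom (Y (f p)))); apply: near_cdom.
have fgE : \forall x \near cmap (X p) p,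
    ((cmap (Z (g (f p))) \o g \o cinv (Y (f p))) \o
     (cmap (Y (f p)) \o f \o cinv (X p))) x =
    (cmap (Z ((g \o f) p)) \o (g \o f) \o cinv (X p)) x.
  by apply: filterS cf => x qx /=; rewrite cinvK.
have gd' : differentiable (cmap (Z (g (f p))) \o g \o cinv (Y (f p)))
    ((cmap (Y (f p)) \o f \o cinv (X p)) (cmap (X p) p)).
  by rewrite /= cinvK.
have [dgf dgfE] := near_eq_differentiable fgE (differentiable_comp fd gd').
split; first by split=> //; apply: continuous_comp.
by move=> u; rewrite /tangent_map dgfE (diff_comp fd gd')/= cinvK.
Qed.

End TangentComp.

End Charts.

(** * The adjoint representation and the Killing form *)

Section ModelParam.
Context {R : realType}.

Lemma param_model (E F : normedModType R) (U : set F) (f : F -> E) :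
  smooth_on U f -> param (@model_atlas R E) U f.
Proof.
move=> fs; apply/paramP; split=> [|q]; first exact: (fs 0%N).
by apply: smooth_on_sub fs => x [].
Qed.

Lemma differentiable_slice (V W Z : normedModType R) (F : V * W -> Z) x y :
  differentiable F (x, y) -> differentiable (fun y' => F (x, y')) y.
Proof.
move=> dF.
have dp : differentiable (fun y' : W => (x, y')) y.
  by apply: differentiable_pair => //; exact: differentiable_cst.
exact: (differentiable_comp dp dF).
Qed.

Lemma diff_slice (V W Z : normedModType R) (F : V * W -> Z) x y v :
  differentiable F (x, y) ->
  'd (fun y' => F (x, y')) y v = 'd F (x, y) (0, v).
Proof.
move=> dF.
have dc : differentiable (cst x : W -> V) y := differentiable_cst _ _.
have di : differentiable (id : W -> W) y by [].
have dp : differentiable (fun y' : W => (cst x y', id y')) y.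
  exact: differentiable_pair.
have -> : (fun y' => F (x, y')) = F \o (fun y' : W => (cst x y', id y')) by [].
by rewrite (diff_comp dp dF)/= (diff_pair dc di) diff_cst diff_val.
Qed.

Lemma diff_lincomb (V W : normedModType R) a (f g : V -> W) x u :
  differentiable f x -> differentiable g x ->
  'd (fun y => a *: f y + g y) x u = a *: 'd f x u + 'd g x u.
Proof.
move=> df dg.
by rewrite (diffD (differentiableZ a df) dg) (diffZ a df).
Qed.

Lemma lin1_mxE n p (f : 'rV[R]_n -> 'rV[R]_p) u :
  linear f -> u *m lin1_mx f = f u.
Proof.
move=> fl.
pose L : {linear 'rV[R]_n -> 'rV[R]_p} :=
  HB.pack f (GRing.isLinear.Build _ _ _ _ _ fl).
exact: (mul_rV_lin1 L).
Qed.

Lemma diff_linear_comp (V W Z : normedModType R) (l : W -> Z) (f : V -> W) x u :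
  linear l -> continuous l -> differentiable f x ->
  'd (l \o f) x u = l ('d f x u).
Proof.
move=> ll lc df.
pose L : {linear W -> Z} := HB.pack l (GRing.isLinear.Build _ _ _ _ _ ll).
have dL : differentiable L (f x) by apply: linear_differentiable.
have := congr1 (fun h => h u) (diff_comp df dL).
by rewrite /= (diff_lin _ (f := L)).
Qed.

Lemma mxtrace_conj n (P P' A B : 'M[R]_n) : P *m P' = 1%:M ->
  \tr (P' *m A *m P *m (P' *m B *m P)) = \tr (A *m B).
Proof.
move=> PP'; rewrite -!mulmxA (mulmxA P) PP' mul1mx mxtrace_mulC -!mulmxA PP'.
by rewrite mulmx1.
Qed.

Lemma eq_lin1_mx n p (f g : 'rV[R]_n -> 'rV[R]_p) :
  f =1 g -> lin1_mx f = lin1_mx g.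
Proof. by move=> /funext ->. Qed.

Lemma lin1_mx_comp n p q (f : 'rV[R]_p -> 'rV[R]_q) (g : 'rV[R]_n -> 'rV[R]_p) :
  linear f -> lin1_mx (f \o g) = lin1_mx g *m lin1_mx f.
Proof.
move=> fl; apply/row_matrixP => i; rewrite row_mul.
have -> : row i (lin1_mx g) = g (delta_mx 0 i).
  by apply/rowP => j; rewrite !mxE.
by rewrite lin1_mxE//; apply/rowP => j; rewrite !mxE.
Qed.

End ModelParam.

Section Adjoint.
Context {R : realType} {n : nat} {G : topoGroupType}.
Context {X : G -> chart G 'rV[R]_n}.
Hypothesis lieG : lie_group X.

Let sX : smooth_manifold X. Proof. by case: lieG. Qed.
Let cX : charted X. Proof. exact: smooth_manifold_charted sX. Qed.
Let cXX : charted (prod_atlas X X). Proof. exact: charted_prod. Qed.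
Let dE : fin_dim ('rV[R]_n : normedModType R). Proof. exact: fin_dim_rV. Qed.
Let dEE : fin_dim ('rV[R]_n * 'rV[R]_n : normedModType R)%type.
Proof. exact: fin_dim_prod. Qed.

Section ParamGroup.
Context {F : normedModType R} {U : set F}.
Hypothesis oU : open U.

Lemma param_mul (f g : F -> G) : param X U f -> param X U g ->
  param X U (fun x => f x * g x)%g.
Proof.
move=> fs gs; have [_ mulG _] := lieG.
exact: (param_comp cXX cX dEE oU openT (fun _ _ => I)
          (param_pair cX cX oU fs gs) mulG).
Qed.

Lemma param_inv (f : F -> G) : param X U f -> param X U (fun x => (f x)^-1)%g.
Proof.
move=> fs; have [_ _ invG] := lieG.
exact: (param_comp cX cX dE oU openT (fun _ _ => I) fs invG).
Qed.

End ParamGroup.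

Definition conj (a x : G) : G := (a * x * a^-1)%g.

Lemma conj1 a : conj a 1%g = 1%g. Proof. by rewrite /conj mulg1 mulgV. Qed.

Lemma conjM a b : conj (a * b)%g = conj a \o conj b.
Proof. by apply/funext => x; rewrite /conj/= invgM !mulgA. Qed.

Lemma conj_one : conj 1%g = id.
Proof. by apply/funext => x; rewrite /conj mul1g invg1 mulg1. Qed.

Lemma mdiff_mull a p : mdiff X X (fun x => a * x)%g p.
Proof.
apply: (mdiff_param cX cX (cimg_center cX p)); apply: param_mul.
- exact: cimg_open.
- exact: param_cst.
- exact: param_cinv.
Qed.

Lemma mdiff_mulr a p : mdiff X X (fun x => x * a)%g p.
Proof.
apply: (mdiff_param cX cX (cimg_center cX p)); apply: param_mul.
- exact: cimg_open.
- exact: param_cinv.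
- exact: param_cst.
Qed.

Lemma mdiff_conj a p : mdiff X X (conj a) p.
Proof.
apply: (mdiff_param cX cX (cimg_center cX p)); apply: param_mul.
- exact: cimg_open.
- by apply: param_mul; [exact: cimg_open|exact: param_cst|exact: param_cinv].
- exact: param_cst.
Qed.

Lemma Ad_linear a : linear (Ad X a).
Proof. exact: tangent_linear. Qed.

Lemma Ad_fun_continuous a : continuous (Ad X a).
Proof.
pose L : {linear 'rV[R]_n -> 'rV[R]_n} :=
  HB.pack (Ad X a) (GRing.isLinear.Build _ _ _ _ _ (Ad_linear a)).
exact: (@rV_linear_continuous R n 'rV[R]_n L).
Qed.

Lemma Ad1 u : Ad X 1%g u = u.
Proof.
rewrite /Ad -/(conj 1%g) conj_one.
by have [_ ->] := tangent_id cX 1%g.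
Qed.

Lemma AdM a b u : Ad X (a * b)%g u = Ad X a (Ad X b u).
Proof.
rewrite {1}/Ad -/(conj (a * b)%g) conjM.
have [_ ->] := tangent_comp cX cX (mdiff_conj b 1%g) (mdiff_conj a (conj b 1%g)).
by rewrite conj1.
Qed.

Lemma AdK a : cancel (Ad X a) (Ad X a^-1%g).
Proof. by move=> u; rewrite -AdM mulVg Ad1. Qed.

Lemma AdVK a : cancel (Ad X a^-1%g) (Ad X a).
Proof. by move=> u; rewrite -AdM mulgV Ad1. Qed.

Let x1 := cmap (X 1%g) 1%g.
Let g_ := cinv (X 1%g).

Lemma AdE a v : Ad X a v = 'd (cmap (X 1%g) \o conj a \o g_) x1 v.
Proof. by rewrite /Ad /tangent_map (conj1 a : a * 1 * a^-1 = 1)%g. Qed.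

(** In the chart at 1 the differential of conjugation is the partial derivative
    in y of the chart expression of (x, y) |-> x y x^-1, hence depends smoothly
    on x. *)
Lemma smooth_Ad v : smooth_on (cimg (X 1%g)) (fun x => Ad X (g_ x) v).
Proof.
set C := cimg (X 1%g); have oC : open C by apply: cimg_open.
pose psi (z : 'rV[R]_n * 'rV[R]_n) : G := conj (g_ z.1) (g_ z.2).
have oCC : open (C `*` C) by apply: open_setX.
have fstc : continuous (fst : 'rV[R]_n * 'rV[R]_n -> _).
  by move=> z; apply: cvg_fst.
have sndc : continuous (snd : 'rV[R]_n * 'rV[R]_n -> _).
  by move=> z; apply: cvg_snd.
have p1 : param X (C `*` C) (g_ \o fst).
  apply: (param_precomp (V := C)) => //; first by move=> z [].
    exact: smooth_on_linear.
  exact: param_cinv.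
have p2 : param X (C `*` C) (g_ \o snd).
  apply: (param_precomp (V := C)) => //; first by move=> z [].
    exact: smooth_on_linear.
  exact: param_cinv.
have ppsi : param X (C `*` C) psi.
  by apply: param_mul => //; [apply: param_mul|apply: param_inv].
pose W := (C `*` C) `&` psi @^-1` cdom (X 1%g).
have /paramP[psic _] := ppsi.
have oW : open W by apply: open_preimage_on => //; apply: cdom_open.
pose F := cmap (X 1%g) \o psi.
have FW : smooth_on W F.
  by apply: param_smooth_on; [apply: param_sub ppsi => z []|move=> z []].
have g1 : g_ x1 = 1%g by rewrite /g_ cinvK//; apply: cdom_center.
have Wx x : C x -> W (x, x1).
  move=> Cx; split; first by split=> //; apply: cimg_center.
  by rewrite /psi/= g1 conj1; apply: cdom_center.
have ps : smooth_on C (fun x : 'rV[R]_n => (x, x1)).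
  apply: smooth_on_pair => //; last by move=> k; apply: Ck_cst.
  by apply: (smooth_on_linear _ (f := idfun)) => x; apply: cvg_id.
apply: (@smooth_on_ext _ _ _ _ ((fun z => 'd F z (0, v)) \o (fun x => (x, x1)))).
- exact: oC.
- move=> x Cx /=.
  have dF := smooth_on_differentiable FW (Wx x Cx).
  by rewrite AdE -(diff_slice _ dF).
- apply: (smooth_on_comp dEE oC Wx ps).
  exact: smooth_on_diff.
Qed.

Lemma diff_Ad v : differentiable (fun x => Ad X (g_ x) v) x1.
Proof. exact: smooth_on_differentiable (smooth_Ad v) (cimg_center cX _). Qed.

Lemma mdiff_Ad v : mdiff X (@model_atlas R 'rV[R]_n) (fun a => Ad X a v) 1%g.
Proof.
apply: (mdiff_param cX (@charted_model R _) (cimg_center cX 1%g)).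
exact/param_model/smooth_Ad.
Qed.

(** Differentiability at 1 gives continuity there, and the homomorphism property
    moves it to every point. *)
Lemma Ad_continuous v : continuous (fun a => Ad X a v).
Proof.
move=> a.
have -> : (fun b => Ad X b v) =
    Ad X a \o ((fun b => Ad X b v) \o (fun b => (a^-1 * b)%g)).
  by apply/funext => b /=; rewrite -AdM mulVKg.
apply: continuous_comp; last exact: Ad_fun_continuous.
apply: continuous_comp; first by have [] := mdiff_mull a^-1%g a.
by rewrite mulVg; have [] := mdiff_Ad v.
Qed.

Lemma lie_bracketE u v :
  lie_bracket X u v = 'd (fun x => Ad X (g_ x) v) x1 u.
Proof. by []. Qed.

Lemma lie_bracket_linearl v : linear (lie_bracket X ^~ v).
Proof. by move=> a u w; rewrite !lie_bracketE linearP. Qed.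

Lemma lie_bracket_linearr u : linear (lie_bracket X u).
Proof.
move=> a v w; rewrite !lie_bracketE.
have -> : (fun x => Ad X (g_ x) (a *: v + w)) =
    fun x => a *: Ad X (g_ x) v + Ad X (g_ x) w.
  by apply/funext => x; rewrite Ad_linear.
exact: (@diff_lincomb R 'rV[R]_n 'rV[R]_n a _ _ _ u (diff_Ad v) (diff_Ad w)).
Qed.

(** Ad a is the differential of the automorphism x |-> a x a^-1, so it is an
    automorphism of the Lie algebra. *)
Lemma Ad_bracket a u v :
  Ad X a (lie_bracket X u v) = lie_bracket X (Ad X a u) (Ad X a v).
Proof.
have E : (fun x => Ad X x (Ad X a v)) \o conj a = Ad X a \o (fun x => Ad X x v).
  by apply/funext => x /=; rewrite -!AdM /conj mulgVK.
have mdiffAd : mdiff X (@model_atlas R 'rV[R]_n) (fun x => Ad X x (Ad X a v))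
    (conj a 1%g) by rewrite conj1; apply: mdiff_Ad.
have [_ dE1] := tangent_comp cX cX (mdiff_conj a 1%g) mdiffAd.
have {}dE1 := dE1 u; rewrite conj1 E in dE1.
have dE2 : tangent_map X (@model_atlas R 'rV[R]_n)
    (Ad X a \o (fun x => Ad X x v)) 1%g u = Ad X a (lie_bracket X u v).
  exact: (diff_linear_comp _ (Ad_linear a) (@Ad_fun_continuous a) (diff_Ad v)).
exact: (etrans (esym dE2) dE1).
Qed.

Definition Ad_mx a := lin1_mx (Ad X a).
Definition ad_mx u := lin1_mx (lie_bracket X u).

Lemma Ad_mxE a u : u *m Ad_mx a = Ad X a u.
Proof. exact/lin1_mxE/Ad_linear. Qed.

Lemma ad_mxE u v : v *m ad_mx u = lie_bracket X u v.
Proof. exact/lin1_mxE/lie_bracket_linearr. Qed.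

Lemma Ad_mx1 : Ad_mx 1%g = 1%:M.
Proof.
by apply/row_matrixP => i; rewrite !rowE Ad_mxE Ad1 mulmx1.
Qed.

Lemma Ad_mxM a b : Ad_mx (a * b)%g = Ad_mx b *m Ad_mx a.
Proof.
rewrite -(lin1_mx_comp _ (Ad_linear a)).
by apply: eq_lin1_mx => u; rewrite /= AdM.
Qed.

Lemma ad_mx_linear : linear ad_mx.
Proof.
move=> a u v; apply/matrixP => i j; rewrite !mxE.
by rewrite lie_bracket_linearl !mxE.
Qed.

Lemma ad_mx_Ad a u :
  ad_mx (Ad X a u) = Ad_mx a^-1%g *m ad_mx u *m Ad_mx a.
Proof.
have al := Ad_linear a; have ul := lie_bracket_linearr u.
rewrite -mulmxA -(lin1_mx_comp _ al) -lin1_mx_comp; last first.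
  by move=> c v w; rewrite /= ul al.
apply: eq_lin1_mx => v /=.
by rewrite Ad_bracket AdVK.
Qed.

Lemma killingE u v : killing X u v = \tr (ad_mx u *m ad_mx v).
Proof.
rewrite /killing lin1_mx_comp; first exact: mxtrace_mulC.
exact: lie_bracket_linearr.
Qed.

Lemma killingC u v : killing X u v = killing X v u.
Proof. by rewrite !killingE mxtrace_mulC. Qed.

Lemma killing_linearl v : linear (killing X ^~ v).
Proof.
move=> a u w; rewrite !killingE ad_mx_linear mulmxDl -scalemxAl.
by rewrite mxtraceD mxtraceZ.
Qed.

Lemma killing_Ad a u v : killing X (Ad X a u) (Ad X a v) = killing X u v.
Proof.
rewrite !killingE !ad_mx_Ad; apply: mxtrace_conj.
by rewrite -Ad_mxM mulVg Ad_mx1.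
Qed.

(** The derivative at 1 of the identity expressing that a form is invariant
    under the adjoint group. *)
Lemma ad_mx_skew (Q : 'M[R]_n) u :
  (forall a, Ad_mx a *m Q *m (Ad_mx a)^T = Q) ->
  ad_mx u *m Q + Q *m (ad_mx u)^T = 0.
Proof.
move=> AdQ.
pose b (v w : 'rV[R]_n) : R := (v *m Q *m w^T) 0 0.
have bl w : linear (b^~ w).
  by move=> c v v'; rewrite /b !mulmxDl -!scalemxAl !mxE.
have br v : linear (b v).
  by move=> c w w'; rewrite /b linearP/= mulmxDr -scalemxAr !mxE.
have bE v w : b (v *m ad_mx u) w + b v (w *m ad_mx u) = 0.
  have := diff_form bl br u (diff_Ad v) (diff_Ad w).
  rewrite !ad_mxE !lie_bracketE.
  have -> : (fun x => b (Ad X (g_ x) v) (Ad X (g_ x) w)) = cst (b v w).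
    apply/funext => x; rewrite /b -!Ad_mxE trmx_mul /=.
    by rewrite -[in RHS](AdQ (g_ x)) !mulmxA.
  rewrite diff_cst /g_ /x1 cinvK//; last exact: cdom_center.
  by rewrite !Ad1 addrC => <-.
apply/matrixP => i j; rewrite [RHS]mxE -[RHS](bE (delta_mx 0 i) (delta_mx 0 j)).
rewrite /b trmx_mul trmx_delta !mulmxA -!rowE -!colE !mxE.
congr (_ + _); apply: eq_bigr => k _; rewrite !mxE//.
Qed.

End Adjoint.

(** * Bounded groups of matrices preserve an inner product *)

Section BoundedGroup.
Context {R : realType}.

Lemma cauchy_schwarz_sum n (a b : 'I_n -> R) :
  (\sum_i a i * b i) ^+ 2 <= (\sum_i a i ^+ 2) * (\sum_i b i ^+ 2).
Proof.
have H : 0 <= \sum_i \sum_j (a i * b j - a j * b i) ^+ 2.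
  by apply: sumr_ge0 => i _; apply: sumr_ge0 => j _; apply: sqr_ge0.
have E : \sum_i \sum_j (a i * b j - a j * b i) ^+ 2 =
    \sum_i \sum_j (a i ^+ 2 * b j ^+ 2) + \sum_i \sum_j (a j ^+ 2 * b i ^+ 2)
    - (\sum_i \sum_j (a i * b i) * (a j * b j)) *+ 2.
  rewrite -sumrMnl -big_split -sumrB; apply: eq_bigr => i _ /=.
  rewrite -sumrMnl -big_split -sumrB; apply: eq_bigr => j _ /=.
  rewrite sqrrB !exprMn addrAC; congr (_ - _ *+ 2).
  by rewrite mulrACA [b j * b i]mulrC mulrACA.
have P (f g : 'I_n -> R) : \sum_i \sum_j f i * g j = (\sum_i f i) * (\sum_j g j).
  by rewrite mulr_suml; apply: eq_bigr => i _; rewrite mulr_sumr.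
move: H; rewrite E [X in _ + X - _]exchange_big/= !P -mulr2n -mulrnBl.
by rewrite pmulrn_lge0// subr_ge0 expr2.
Qed.

Lemma cluster_le (T : topologicalType) (u : nat -> T) p (f : T -> R) r :
  cluster (u @ \oo) p -> continuous f ->
  (\forall k \near \oo, f (u k) <= r) -> f p <= r.
Proof.
rewrite clusterE => up fc ur.
have cl : closed (f @^-1` [set x | x <= r]).
  by apply: closed_comp; [move=> x _; apply: fc|exact: closed_le].
have := up (f @^-1` [set x | x <= r]) ur.
by rewrite -(iffLR (closure_id _) cl).
Qed.

Lemma bounded_seq_cluster n (u : nat -> 'rV[R]_n) (B : R) :
  (forall k i, `|u k 0 i| <= B) -> exists p, cluster (u @ \oo) p.
Proof.
move=> uB.
have /(_ (u @ \oo) _)[|p [_ pc]] := @rV_compact R n (fun=> `[-B, B]%classic)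
    (fun=> @segment_compact R (-B) B); last by exists p.
by exists 0%N => // k _ i /=; rewrite in_itv/= -ler_norml; apply: uB.
Qed.

Lemma linear_comp_vec_mx m n (l : 'M[R]_(m, n) -> R) :
  linear l -> linear (l \o vec_mx).
Proof. by move=> ll a v w; rewrite /= linearP ll. Qed.

(** The squared Frobenius norm. *)
Definition nsq m n (A : 'M[R]_(m, n)) : R := \sum_i \sum_j A i j ^+ 2.

Lemma nsq_ge0 m n (A : 'M[R]_(m, n)) : 0 <= nsq A.
Proof. by apply: sumr_ge0 => i _; apply: sumr_ge0 => j _; apply: sqr_ge0. Qed.

Lemma nsq_eq0 m n (A : 'M[R]_(m, n)) : nsq A <= 0 -> A = 0.
Proof.
move=> A0; have /eqP : nsq A = 0 by apply: le_anti; rewrite A0 nsq_ge0.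
rewrite psumr_eq0 => [/allP rA|i _]; last first.
  by apply: sumr_ge0 => j _; apply: sqr_ge0.
apply/matrixP => i j; have := rA i (mem_index_enum _).
rewrite psumr_eq0 => [/allP/(_ j (mem_index_enum _))|k _]; last exact: sqr_ge0.
by rewrite /= sqrf_eq0 mxE => /eqP.
Qed.

Lemma nsq_entry m n (A : 'M[R]_(m, n)) i j : A i j ^+ 2 <= nsq A.
Proof.
rewrite /nsq (bigD1 i)//= (bigD1 j)//= -addrA lerDl addr_ge0//.
  by apply: sumr_ge0 => k _; apply: sqr_ge0.
by apply: sumr_ge0 => k _; apply: sumr_ge0 => l _; apply: sqr_ge0.
Qed.

Lemma nsq_tr m n (A : 'M[R]_(m, n)) : nsq A^T = nsq A.
Proof.
rewrite /nsq exchange_big/=; apply: eq_bigr => i _; apply: eq_bigr => j _.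
by rewrite mxE.
Qed.

Lemma nsq_mul m n p (A : 'M[R]_(m, n)) (B : 'M[R]_(n, p)) :
  nsq (A *m B) <= nsq A * nsq B.
Proof.
rewrite {2}/nsq mulr_suml; apply: ler_sum => i _.
rewrite -(nsq_tr B) mulr_sumr; apply: ler_sum => j _.
rewrite mxE; apply: le_trans (cauchy_schwarz_sum _ _) _.
by under [X in _ <= _ * X]eq_bigr do rewrite mxE.
Qed.

Lemma sqr_midpoint (x y : R) : (2^-1 * (x + y)) ^+ 2 =
  2^-1 * x ^+ 2 + 2^-1 * y ^+ 2 - (2^-1 * (x - y)) ^+ 2.
Proof.
have half (z : R) : 2^-1 * z ^+ 2 = (2^-1 * z) ^+ 2 + (2^-1 * z) ^+ 2.
  rewrite exprMn -mulrDl expr2 -mulrDl; congr (_ * _).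
  by have := splitr (1 : R); rewrite !mul1r => <-; rewrite mul1r.
rewrite !half mulrDr mulrBr; move: (2^-1 * x) (2^-1 * y) => a b.
apply/eqP; rewrite eq_sym subr_eq sqrrD sqrrB [X in _ == X]addrACA.
by rewrite [a ^+ 2 + _ + (a ^+ 2 - _)]addrACA subrr addr0.
Qed.

Lemma nsq_midpoint m n (A B : 'M[R]_(m, n)) : nsq (2^-1 *: (A + B)) =
  2^-1 * nsq A + 2^-1 * nsq B - nsq (2^-1 *: (A - B)).
Proof.
rewrite /nsq !mulr_sumr -big_split -sumrB/=; apply: eq_bigr => i _.
rewrite !mulr_sumr -big_split -sumrB/=; apply: eq_bigr => j _.
by rewrite !mxE sqr_midpoint.
Qed.

Lemma nsq_row n (v : 'rV[R]_n) : (v *m v^T) 0 0 = nsq v.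
Proof.
rewrite /nsq big_ord1 mxE; apply: eq_bigr => j _.
by rewrite mxE expr2.
Qed.

Section Invariant.
Context {n : nat} (Gam : set 'M[R]_n) (K : R).
Hypotheses (K0 : 0 < K) (Gam1 : Gam 1%:M).
Hypothesis GamM : forall A B, Gam A -> Gam B -> Gam (A *m B).
Hypothesis GamV : forall A, Gam A -> exists2 B, Gam B & B *m A = 1%:M.
Hypothesis GamK : forall A, Gam A -> nsq A <= K.

Let q (Q : 'M[R]_n) (v : 'rV[R]_n) : R := (v *m Q *m v^T) 0 0.
Let act (A Q : 'M[R]_n) := A *m Q *m A^T.

Let actM A B Q : act (A *m B) Q = act A (act B Q).
Proof. by rewrite /act trmx_mul !mulmxA. Qed.

Let act1 Q : act 1%:M Q = Q.
Proof. by rewrite /act mul1mx trmx1 mulmx1. Qed.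

Let q_act A Q v : q (act A Q) v = q Q (v *m A).
Proof. by rewrite /q /act trmx_mul !mulmxA. Qed.

Let nsq_act_le A D : Gam A -> nsq (act A D) <= K * K * nsq D.
Proof.
move=> GA; rewrite /act; apply: le_trans (nsq_mul _ _) _.
have nA := GamK GA; have := nsq_mul A D; rewrite nsq_tr => AD.
have h1 : nsq (A *m D) <= K * nsq D.
  by apply: le_trans AD _; apply: ler_wpM2r => //; apply: nsq_ge0.
rewrite mulrC -mulrA.
apply: ler_pM => //; exact: nsq_ge0.
Qed.

Let nsq_act_ge A D : Gam A -> nsq D <= K * K * nsq (act A D).
Proof.
move=> GA; have [B GB BA] := GamV GA.
by rewrite -{1}[D]act1 -BA actM; apply: nsq_act_le.
Qed.

(** The constraint defining the convex set of the minimization.  It bounds the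
    form below along its whole orbit, which makes it stable under the group, and
    the bound survives limits, so that limits stay positive definite. *)
Let bounded_below Q := Q^T = Q /\ forall A v, Gam A -> nsq v <= K * q Q (v *m A).

Let sublevel r Q := bounded_below Q /\ forall A, Gam A -> nsq (act A Q) <= r.

Let bounded_below1 : bounded_below 1%:M.
Proof.
split=> [|A v GA]; first exact: trmx1.
rewrite /q mulmx1 nsq_row; have [B GB BA] := GamV GA.
have AB : A *m B = 1%:M by apply: mulmx1C.
rewrite -{1}[v]mulmx1 -AB mulmxA; apply: le_trans (nsq_mul _ _) _.
by rewrite mulrC; apply: ler_wpM2r; [apply: nsq_ge0|apply: GamK].
Qed.

Let bounded_below_act A Q : Gam A -> bounded_below Q -> bounded_below (act A Q).
Proof.
move=> GA [Qs Qq]; split=> [|B v GB].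
  by rewrite /act !trmx_mul trmxK Qs mulmxA.
by rewrite q_act -mulmxA; apply: Qq; apply: GamM.
Qed.

Let bounded_below_mid Q Q' : bounded_below Q -> bounded_below Q' ->
  bounded_below (2^-1 *: (Q + Q')).
Proof.
move=> [Qs Qq] [Qs' Qq']; split=> [|A v GA].
  by rewrite linearZ linearD/= Qs Qs'.
have -> : q (2^-1 *: (Q + Q')) (v *m A) =
    2^-1 * (q Q (v *m A) + q Q' (v *m A)).
  rewrite /q -scalemxAr -scalemxAl mulmxDr mulmxDl.
  by rewrite !mxE.
rewrite mulrCA mulrDr -ler_pdivrMl ?invr_gt0// invrK mulr_natl mulr2n.
by apply: lerD; [apply: Qq|apply: Qq'].
Qed.

Let sublevel_le r r' Q : r <= r' -> sublevel r Q -> sublevel r' Q.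
Proof.
by move=> rr' [bQ Qr]; split=> // A /Qr /le_trans; apply.
Qed.

Let sublevel_inf := inf [set r | exists Q, sublevel r Q].

Let sublevel_has_inf : has_inf [set r | exists Q, sublevel r Q].
Proof.
split.
  exists (K * K * nsq (1%:M : 'M[R]_n)), 1%:M; split=> // A GA.
  exact: nsq_act_le.
by exists 0 => r [Q [_ Qr]]; apply: le_trans (Qr _ Gam1); apply: nsq_ge0.
Qed.

(** The sublevel sets of Q |-> sup over the group of |A Q A^T|^2 are compact, so a
    cluster point of a minimizing sequence realizes the infimum. *)
Let minimizer : exists Q, sublevel sublevel_inf Q.
Proof.
have : forall k, exists Q, sublevel (sublevel_inf + k.+1%:R^-1) Q.
  move=> k; have k0 : 0 < k.+1%:R^-1 :> R by rewrite invr_gt0.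
  have [r [Q Qr] rlt] := inf_adherent k0 sublevel_has_inf.
  by exists Q; apply: sublevel_le Qr; apply: ltW.
move=> /choice[Q_ Q_r].
have [p pc] : exists p, cluster ((fun k => mxvec (Q_ k)) @ \oo) p.
  (* taking A = 1 in the definition of the sublevel sets bounds |Q_ k|^2 *)
  apply: (bounded_seq_cluster (B := Num.sqrt (sublevel_inf + 1))) => k i.
  case/mxvec_indexP: i => i j; rewrite mxvecE -sqrtr_sqr ler_wsqrtr//.
  apply: le_trans (nsq_entry _ i j) _; have [_ /(_ _ Gam1)] := Q_r k.
  rewrite act1 => /le_trans; apply; rewrite lerD2l invf_le1// ler1n.
  by [].
have lc (l : 'M[R]_n -> R) : linear l -> continuous (l \o vec_mx).
  move=> ll; pose L : {linear 'rV[R]_(n * n) -> R} := HB.pack (l \o vec_mx)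
    (GRing.isLinear.Build _ _ _ _ _ (linear_comp_vec_mx ll)).
  exact: (@rV_linear_continuous R (n * n) R L).
have lim_le (l : 'M[R]_n -> R) r : linear l -> (forall k, l (Q_ k) <= r) ->
    l (vec_mx p) <= r.
  move=> ll lr; apply: (cluster_le pc (lc _ ll)); near=> k.
  by rewrite /= mxvecK.
exists (vec_mx p); split; first split.
- have entry i j : linear (fun Q : 'M[R]_n => Q i j - Q j i).
    move=> a Q Q'; rewrite !mxE opprD addrACA -mulrBr; congr (_ + _).
  have sym_le i j : vec_mx p i j <= vec_mx p j i.
    rewrite -subr_le0; apply: (lim_le _ _ (entry i j)) => k.
    by have [[Qs _] _] := Q_r k; rewrite -[in X in _ - X]Qs mxE subrr.
  by apply/matrixP => i j; apply: le_anti; rewrite mxE !sym_le.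
- move=> A v GA.
  have ql : linear (fun Q => - (K * q Q (v *m A))).
    move=> a Q Q'; rewrite /q mulmxDr mulmxDl -scalemxAr -scalemxAl !mxE.
    by rewrite mulrDr opprD mulrCA -mulrN.
  rewrite -lerN2; apply: (lim_le _ _ ql) => k.
  by rewrite lerN2; have [[_ Qq] _] := Q_r k; apply: Qq.
- move=> A GA; apply/ler_addgt0Pr => e e0.
  have fc : continuous (fun w : 'rV[R]_(n * n) => nsq (act A (vec_mx w))).
    have C0 : Ck 0 setT (fun w : 'rV[R]_(n * n) => nsq (act A (vec_mx w))).
      rewrite /nsq; apply: Ck_sum; first exact: openT.
      move=> i; apply: Ck_sum; first exact: openT.
      move=> j; under eq_fun do rewrite expr2.
      have ll : linear (fun Q : 'M[R]_n => act A Q i j).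
        move=> a Q Q'; rewrite /act mulmxDr mulmxDl -scalemxAr -scalemxAl.
        by rewrite !mxE.
      have cl : Ck 0 setT (fun w : 'rV[R]_(n * n) => act A (vec_mx w) i j).
        by move=> w _; apply: (lc _ ll).
      by apply: (Ck_scale _ cl cl); apply: openT.
    by move=> w; apply: C0.
  apply: (cluster_le pc fc); near=> k; rewrite /= mxvecK.
  have [_ /(_ _ GA) /le_trans] := Q_r k; apply; rewrite lerD2l.
  by apply: ltW; near: k; exact: (near_infty_natSinv_lt (PosNum e0)).
Unshelve. all: by end_near. Qed.

(** If A moved the minimizer Q, the midpoint of Q and A Q A^T would be strictly
    better than the infimum, by the parallelogram identity. *)
Lemma bounded_group_invariant_form : exists Q : 'M[R]_n,
  [/\ Q^T = Q, forall v : 'rV[R]_n, v != 0 -> 0 < (v *m Q *m v^T) 0 0 &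
      forall A, Gam A -> A *m Q *m A^T = Q].
Proof.
have [Q [bQ Qr]] := minimizer; have [Qs Qq] := bQ; exists Q; split=> //.
  move=> v v0; have := Qq _ v Gam1; rewrite mulmx1 => vq.
  have : 0 < nsq v.
    rewrite lt_def nsq_ge0 andbT; apply: contra v0 => /eqP v0.
    by apply/eqP/nsq_eq0; rewrite v0.
  by move=> /lt_le_trans/(_ vq); rewrite pmulr_rgt0.
move=> A GA; apply/eqP; rewrite -subr_eq0; apply/eqP.
set D := act A Q - Q.
suff D0 : 2^-1 *: D = 0 by rewrite -[D]scale1r -(@divff _ 2)// -scalerA D0 scaler0.
apply: nsq_eq0; rewrite -(pmulr_rle0 _ (_ : 0 < (K * K)^-1)) ?invr_gt0 ?mulr_gt0//.
(* c bounds below the gain of the midpoint at every element of the group, because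
   the action divides squared norms by at most K * K *)
set c := (K * K)^-1 * _.
suff : sublevel (sublevel_inf - c) (2^-1 *: (act A Q + Q)).
  move=> mid; have : sublevel_inf <= sublevel_inf - c.
    by apply: ge_inf; [case: sublevel_has_inf|eexists; exact: mid].
  by rewrite lerBrDr gerDl.
split; first by apply: bounded_below_mid => //; apply: bounded_below_act.
move=> B GB.
have -> : act B (2^-1 *: (act A Q + Q)) = 2^-1 *: (act (B *m A) Q + act B Q).
  by rewrite actM {1}/act -scalemxAr -scalemxAl mulmxDr mulmxDl.
rewrite nsq_midpoint; apply: lerB.
  rewrite [leRHS](_ : _ = 2^-1 * sublevel_inf + 2^-1 * sublevel_inf).
    by apply: lerD; apply: ler_wpM2l => //; apply: Qr => //; apply: GamM.
  by rewrite mulrC -splitr.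
have -> : 2^-1 *: (act (B *m A) Q - act B Q) = act B (2^-1 *: D).
  by rewrite actM /D [RHS]/act -scalemxAr -scalemxAl mulmxBr mulmxBl.
by rewrite /c ler_pdivrMl ?mulr_gt0//; apply: nsq_act_ge.
Qed.

End Invariant.

(** Induction on the size: the factor of the Schur complement S of the corner a,
    bordered by sqrt a and b / sqrt a. *)
Lemma cholesky n (Q : 'M[R]_n) : Q^T = Q ->
  (forall v : 'rV[R]_n, v != 0 -> 0 < (v *m Q *m v^T) 0 0) ->
  exists2 L : 'M[R]_n, L \in unitmx & Q = L *m L^T.
Proof.
elim: n Q => [|n IH] Q Qs Qp.
  by exists 1%:M; [apply: unitmx1|apply/matrixP => -[]].
rewrite -[n.+1]/(1 + n)%N in Q Qs Qp *.
pose a := ulsubmx Q 0 0; pose b := ursubmx Q; pose D := drsubmx Q.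
have QE : Q = block_mx a%:M b b^T D.
  by rewrite /b trmx_ursub Qs -[in LHS](submxK Q) -(mx11_scalar (ulsubmx Q)).
have a0 : 0 < a.
  have e0 : row_mx 1%:M 0 != 0 :> 'rV[R]_(1 + n).
    apply/eqP => /(congr1 (fun M => lsubmx M 0 0)); rewrite row_mxKl !mxE/=.
    by move/eqP; rewrite oner_eq0.
  have := Qp _ e0; rewrite QE mul_row_block tr_row_mx mul_row_col.
  by rewrite !mul0mx !mul1mx !addr0 trmx0 mulmx0 addr0 trmx1 mulmx1 mxE eqxx.
pose S := D - a^-1 *: (b^T *m b).
have [L' L'u SE] : exists2 L' : 'M[R]_n, L' \in unitmx & S = L' *m L'^T.
  apply: IH => [|w w0].
    have DE : D^T = D by rewrite /D trmx_drsub Qs.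
    by rewrite /S linearB linearZ/= trmx_mul trmxK DE.
  (* the row (x, w) times Q has first entry 0 and remaining part w S *)
  pose x := - a^-1 *: (w *m b^T).
  have v0 : row_mx x w != 0.
    by apply: contra w0 => /eqP/(congr1 rsubmx); rewrite row_mxKr linear0 => ->.
  have := Qp _ v0; rewrite QE mul_row_block tr_row_mx mul_row_col.
  have -> : x *m a%:M + w *m b^T = 0.
    by rewrite mul_mx_scalar /x scalerA mulrN divff ?gt_eqF// scaleN1r addNr.
  rewrite mul0mx add0r; have -> : x *m b + w *m D = w *m S => //.
  rewrite /x /S mulmxBr -scalemxAl -scalemxAr mulmxA scaleNr addrC.
  by [].
pose r := Num.sqrt a; have r0 : 0 < r by rewrite sqrtr_gt0.
have rr : r * r = a by rewrite -expr2 sqr_sqrtr// ltW.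
exists (block_mx r%:M 0 (r^-1 *: b^T) L').
  by rewrite unitmxE det_lblock unitrM det_scalar1 unitfE gt_eqF//= -unitmxE.
rewrite tr_block_mx mulmx_block QE tr_scalar_mx trmx0 linearZ/= trmxK.
rewrite !mul0mx !mulmx0 !addr0 -scalar_mxM rr.
rewrite mul_scalar_mx mul_mx_scalar !scalerA divff ?gt_eqF// !scale1r.
rewrite -scalemxAl -scalemxAr scalerA -invfM rr -SE /S addrC subrK.
by [].
Qed.

(** In an orthonormal basis A becomes antisymmetric and tr (A^2) becomes minus
    its squared Frobenius norm. *)
Lemma skew_trace_lt0 n (Q A : 'M[R]_n) : Q^T = Q ->
  (forall v : 'rV[R]_n, v != 0 -> 0 < (v *m Q *m v^T) 0 0) ->
  A *m Q + Q *m A^T = 0 -> A != 0 -> \tr (A *m A) < 0.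
Proof.
move=> Qs Qp AQ A0; have [L Lu QE] := cholesky Qs Qp.
pose B := invmx L *m A *m L.
have AE : A = L *m B *m invmx L.
  by rewrite /B !mulmxA mulmxV// mul1mx -mulmxA mulmxV// mulmx1.
have BT : B^T = - B.
  apply/eqP; rewrite -addr_eq0 addrC; apply/eqP.
  have LTu : L^T \in unitmx by rewrite unitmx_tr.
  have : invmx L *m (A *m Q + Q *m A^T) *m invmx L^T = 0.
    by rewrite AQ mulmx0 mul0mx.
  rewrite QE mulmxDr mulmxDl /B !trmx_mul trmx_inv !mulmxA.
  rewrite mulVmx// mul1mx -[_ *m L^T *m _]mulmxA mulmxV// mulmx1.
  by rewrite -!mulmxA.
have -> : \tr (A *m A) = - nsq B.
  rewrite -(mxtrace_conj A A (mulmxV Lu)) -/B.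
  rewrite /nsq -sumrN; apply: eq_bigr => i _; rewrite mxE -sumrN.
  apply: eq_bigr => j _; have -> : B j i = - B i j.
    by have /matrixP/(_ i j) := BT; rewrite !mxE.
  by rewrite mulrN expr2.
rewrite oppr_lt0 lt_def nsq_ge0 andbT; apply: contra A0 => /eqP B0.
by rewrite AE (nsq_eq0 (A := B)) ?B0// mulmx0 mul0mx.
Qed.

End BoundedGroup.

Section KillingDefinite.
Context {R : realType} {n : nat} {G : topoGroupType}.
Context {X : G -> chart G 'rV[R]_n}.
Hypotheses (lieG : lie_group X) (cptG : compact [set: G]).
Hypothesis ssG : semisimple X.

Lemma continuous_sum_ord (T : topologicalType) m (f : 'I_m -> T -> R) :
  (forall i, continuous (f i)) -> continuous (fun x => \sum_i f i x).
Proof.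
elim: m f => [|m IH] f fc x.
  by under eq_fun do rewrite big_ord0; apply: cvg_cst.
under eq_fun do rewrite big_ord_recl.
by apply: continuousD; [apply: fc|apply: IH].
Qed.

Lemma Ad_mx_bounded : exists2 K : R, 0 < K & forall a, nsq (Ad_mx (X := X) a) <= K.
Proof.
have c : continuous (fun a => nsq (Ad_mx (X := X) a)).
  apply: continuous_sum_ord => i; apply: continuous_sum_ord => j a.
  have cc : continuous (fun a => Ad_mx (X := X) a i j).
    have -> : (fun a => Ad_mx (X := X) a i j) =
        (fun v : 'rV[R]_n => v 0 j) \o (fun a => Ad X a (delta_mx 0 i)).
      by apply/funext => b; rewrite /= mxE.
    move=> b; apply: continuous_comp; first exact: Ad_continuous.
    exact: coord_continuous.
  by under eq_fun do rewrite expr2; apply: continuousM; apply: cc.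
have [a _ aK] := compact_EVT_max (ex_intro _ 1%g I) cptG (continuous_subspaceT c).
exists (nsq (Ad_mx (X := X) a) + 1) => [|b].
  by rewrite ltr_wpDl// nsq_ge0.
by apply: (le_trans (aK b _)); rewrite ?lerDl// inE.
Qed.

(** Some inner product is Ad(G)-invariant because Ad(G) is bounded; every ad u
    is skew for it, so tr ((ad u)^2) < 0 unless ad u = 0, in which case u is
    orthogonal to everything. *)
Lemma neg_killing_gt0 u : u != 0 -> 0 < - killing X u u.
Proof.
move=> u0; have [K K0 AdK] := Ad_mx_bounded.
pose Gam := [set Ad_mx (X := X) a | a in [set: G]].
have [||||Q [Qs Qp QA]] := @bounded_group_invariant_form R n Gam K K0.
- by exists 1%g => //; apply: Ad_mx1.
- move=> _ _ [a _ <-] [b _ <-]; exists (b * a)%g => //.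
  exact: Ad_mxM.
- move=> _ [a _ <-]; exists (Ad_mx (X := X) a^-1%g); first by exists a^-1%g.
  by rewrite -Ad_mxM// mulgV Ad_mx1.
- by move=> _ [a _ <-].
have sk : ad_mx (X := X) u *m Q + Q *m (ad_mx (X := X) u)^T = 0.
  by apply: ad_mx_skew => // a; apply: QA; exists a.
rewrite oppr_gt0 killingE//; apply: (skew_trace_lt0 Qs Qp sk).
apply: contra u0 => /eqP adu; apply/eqP/ssG => v.
by rewrite killingE// adu mul0mx mxtrace0.
Qed.

End KillingDefinite.

(** * Linear algebra of inner products *)

Section InnerProducts.
Context {R : realType}.

Section Basic.
Context {V : lmodType R} {b : V -> V -> R}.
Hypothesis ib : inner_product b.

Lemma inner_productC u v : b u v = b v u.
Proof. by case: ib. Qed.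

Lemma inner_product_linearl w : linear (b^~ w).
Proof. by move=> a u v; case: ib => _ + _; apply. Qed.

Lemma inner_product_linearr w : linear (b w).
Proof.
by move=> a u v; rewrite ![b w _]inner_productC inner_product_linearl.
Qed.

Lemma inner_product_eq0 u : b u u = 0 -> u = 0.
Proof.
case: ib => _ _ bp bu; apply/eqP; apply: contraT => /bp.
by rewrite bu ltxx.
Qed.

Lemma inner_product_inj u v : (forall w, b u w = b v w) -> u = v.
Proof.
move=> uv; apply/eqP; rewrite -subr_eq0; apply/eqP/inner_product_eq0.
have [_ bl _] := ib; set w := u - v.
by rewrite /w addrC -scaleN1r bl -/w uv mulN1r addNr.
Qed.

End Basic.

(** The map w |-> b w _ to the dual space is injective, hence onto by dimension. *)
Lemma inner_product_riesz (V : vectType R) (b : V -> V -> R) (f : V -> R) :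
  inner_product b -> linear f -> exists w, forall u, b w u = f u.
Proof.
move=> ib fl; pose e := vbasis {:V}.
pose T w : 'rV[R]_(\dim {:V}) := \row_i b w e`_i.
have Tl : linear T.
  by move=> a u v; apply/rowP => i; rewrite !mxE inner_product_linearl.
pose L : {linear V -> 'rV[R]_(\dim {:V})} :=
  HB.pack T (GRing.isLinear.Build _ _ _ _ _ Tl).
have expand (g : V -> R) u : linear g -> g u = \sum_i coord e i u * g e`_i.
  move=> gl; pose g' : {linear V -> R} :=
    HB.pack g (GRing.isLinear.Build _ _ _ _ _ gl).
  rewrite -[LHS]/(g' u) [in LHS](coord_vbasis (memvf u)) linear_sum.
  by apply: eq_bigr => i _; rewrite linearZ.
have ker0 : (lker (linfun L) == 0)%VS.
  apply/lker0P => u v; rewrite !lfunE => /rowP uv.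
  apply: (inner_product_inj ib) => w.
  rewrite !(expand _ _ (inner_product_linearr ib _)).
  by apply: eq_bigr => i _; congr (_ * _); have := uv i; rewrite !mxE.
have full : limg (linfun L) = fullv.
  apply/eqP; rewrite eqEdim subvf/= limg_dim_eq; last first.
    by rewrite capfv; apply/eqP.
  by rewrite [X in (X <= _)%N]dimvf; apply: eq_leq; exact: mul1n.
have /memv_imgP[w _ wE] : \row_i f e`_i \in limg (linfun L).
  by rewrite full memvf.
exists w => u; rewrite (expand _ u fl) (expand _ u (inner_product_linearr ib _)).
by apply: eq_bigr => i _; congr (_ * _); move/rowP: wE => /(_ i); rewrite lfunE !mxE.
Qed.

Lemma inner_product_subvs (V : vectType R) (b : V -> V -> R) (k : {vspace V}) :
  inner_product b -> inner_product (fun u v : subvs_of k => b (vsval u) (vsval v)).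
Proof.
move=> [bc bl bp]; split=> [u v|a u v w|u u0].
- exact: bc.
- by rewrite linearP bl.
- by apply: bp; apply: contra u0 => /eqP u0; apply/eqP/val_inj.
Qed.

(** The projection represents, on k, the functional b w _. *)
Lemma orthogonal_projection (V : vectType R) (b : V -> V -> R) (k : {vspace V}) w :
  inner_product b ->
  exists2 z, z \in k & forall u, u \in k -> b (w - z) u = 0.
Proof.
move=> ib; have br := inner_product_linearr ib.
have wl : linear (fun u : subvs_of k => b w (vsval u)).
  by move=> a u v; rewrite [vsval _]linearP br.
have [z zE] := inner_product_riesz (inner_product_subvs k ib) wl.
exists (vsval z) => [|u uk]; first exact: subvsP.
rewrite (zmod_morphism_linear (inner_product_linearl ib u)).
by have := zE (vsproj k u); rewrite /= vsprojK// => ->; rewrite subrr.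
Qed.

End InnerProducts.

(** * The tangent space of a homogeneous space *)

Section ProductRule.
Context {R : realType}.

Lemma tangent_pair (M N P : topologicalType) (E F D : normedModType R)
    (X : M -> chart M E) (Y : N -> chart N F) (Z : P -> chart P D)
    (f : M -> N) (g : M -> P) p : mdiff X Y f p -> mdiff X Z g p ->
  mdiff X (prod_atlas Y Z) (fun x => (f x, g x)) p /\
  forall u, tangent_map X (prod_atlas Y Z) (fun x => (f x, g x)) p u =
    (tangent_map X Y f p u, tangent_map X Z g p u).
Proof.
move=> [fc fd] [gc gd]; split.
  split; first exact: cvg_pair.
  exact: (differentiable_pair fd gd).
by move=> u; rewrite /tangent_map (diff_pair fd gd).
Qed.

Context {n : nat} {G : topoGroupType} {X : G -> chart G 'rV[R]_n}.
Hypothesis lieG : lie_group X.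

Let sX : smooth_manifold X. Proof. by case: lieG. Qed.
Let cX : charted X. Proof. exact: smooth_manifold_charted sX. Qed.
Let cXX : charted (prod_atlas X X). Proof. exact: charted_prod. Qed.

Let mulG := fun z : G * G => (z.1 * z.2)%g.

Lemma mdiff_mulG z : mdiff (prod_atlas X X) X mulG z.
Proof. by have [_ + _] := lieG => /mdiff_smooth; apply. Qed.

(** Multiplication restricted to either factor at 1 is the identity, so its
    differential at (1, 1) is the sum. *)
Lemma tangent_mulG v w :
  tangent_map (prod_atlas X X) X mulG (1%g, 1%g) (v, w) = v + w.
Proof.
have [mid tid] := tangent_id cX 1%g.
have [mc tc] := tangent_cst (X := X) (Y := X) 1%g 1%g.
have [mi1 ti1] := tangent_pair mid mc; have [mi2 ti2] := tangent_pair mc mid.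
have [_ /(_ v)] := tangent_comp cX cXX mi1 (mdiff_mulG _).
have -> : mulG \o (fun x => (id x, cst 1%g x)) = id.
  by apply/funext => x; rewrite /mulG/= mulg1.
rewrite ti1 !tid tc /= => vE.
have [_ /(_ w)] := tangent_comp cX cXX mi2 (mdiff_mulG _).
have -> : mulG \o (fun x => (cst 1%g x, id x)) = id.
  by apply/funext => x; rewrite /mulG/= mul1g.
rewrite ti2 !tid tc /= => wE.
have -> : (v, w) = 1 *: (v, 0) + (0, w).
  by rewrite scale1r; apply/pair_equal_spec; rewrite /= addr0 add0r.
by rewrite tangent_linear -vE -wE scale1r.
Qed.

Lemma tangent_mul (M : topologicalType) (E : normedModType R)
    (XM : M -> chart M E) (f g : M -> G) p : charted XM ->
  mdiff XM X f p -> mdiff XM X g p -> f p = 1%g -> g p = 1%g ->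
  forall u, tangent_map XM X (fun x => f x * g x)%g p u =
    tangent_map XM X f p u + tangent_map XM X g p u.
Proof.
move=> cM mf mg f1 g1 u; have [mfg tfg] := tangent_pair mf mg.
have [_ /(_ u)] := tangent_comp cM cXX mfg (mdiff_mulG _).
rewrite (_ : mulG \o _ = fun x => (f x * g x)%g)// => ->.
by rewrite tfg f1 g1 tangent_mulG.
Qed.

End ProductRule.

Section Homogeneous.
Context {R : realType} {n : nat} {G : topoGroupType}.
Context {X : G -> chart G 'rV[R]_n}.
Hypothesis lieG : lie_group X.
Context {H : set G}.
Hypothesis subH : subgroup H.
Context {d : nat} {M : topologicalType} {XM : M -> chart M 'rV[R]_d}.
Context {proj : G -> M}.
Hypothesis MGH : homogeneous_space X H XM proj.

Let sX : smooth_manifold X. Proof. by case: lieG. Qed.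
Let cX : charted X. Proof. exact: smooth_manifold_charted sX. Qed.
Let dE k : fin_dim ('rV[R]_k : normedModType R). Proof. exact: fin_dim_rV. Qed.

Lemma homogeneous_smooth : smooth_manifold XM. Proof. by case: MGH. Qed.

Lemma homogeneous_charted : charted XM.
Proof. exact/smooth_manifold_charted/homogeneous_smooth. Qed.

Let sM := homogeneous_smooth.
Let cM := homogeneous_charted.

Lemma proj_smooth : smooth_map X XM setT proj. Proof. by case: MGH. Qed.

Lemma proj_eq a b : proj a = proj b <-> H (a^-1 * b)%g.
Proof. by case: MGH. Qed.

Lemma proj_surj p : exists a, proj a = p. Proof. by case: MGH. Qed.

Lemma projMr a h : H h -> proj (a * h)%g = proj a.
Proof.
by move=> Hh; apply/esym/proj_eq; rewrite mulKg.
Qed.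

Lemma mdiff_proj a : mdiff X XM proj a.
Proof. exact: mdiff_smooth proj_smooth _. Qed.

Lemma param_proj (F : normedModType R) (U : set F) (f : F -> G) : open U ->
  param X U f -> param XM U (proj \o f).
Proof.
by move=> oU fs; apply: (param_comp cX cM (dE n) oU openT _ fs proj_smooth).
Qed.

(** A right translation by an element of H makes any local section send the base
    point to 1.  The last clause is the smoothness of s, in the form in which it is
    used. *)
Lemma unit_section : exists (U : set M) (s : M -> G),
  [/\ open_nbhs (proj 1%g) U, s (proj 1%g) = 1%g,
      forall q, U q -> proj (s q) = q,
      mdiff XM X s (proj 1%g) &
      forall (F : normedModType R) (V : set F) (f : F -> M), open V ->
        (forall x, V x -> U (f x)) -> param XM V f -> param X V (s \o f)].
Proof.
have [_ _ _ _ /(_ (proj 1%g))[U [s [[oU Uo] ss sE]]]] := MGH.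
set a := (s (proj 1%g))^-1%g.
have Ha : H a.
  have := sE _ Uo => /proj_eq; rewrite mulg1.
  by [].
exists U, (fun q => s q * a)%g; split.
- by split.
- by rewrite mulgV.
- by move=> q Uq; rewrite projMr// sE.
- have ms : mdiff XM X s (proj 1%g) by apply: mdiff_smooth ss Uo.
  by have [] := tangent_comp cM cX ms (mdiff_mulr lieG a _).
- move=> F V f oV VU fs; apply: param_mul => //; last exact: param_cst.
  by apply: (param_comp cM cX (dE d) oV oU VU fs ss).
Qed.

Local Notation dproj := (tangent_map X XM proj 1%g).

(** The differential of a local section is a right inverse. *)
Lemma dproj_surj y : exists u, dproj u = y.
Proof.
have [U [s [[oU Uo] s1 sE ms _]]] := unit_section.
exists (tangent_map XM X s (proj 1%g) y).
have [_ /(_ y)] := tangent_comp cM cX ms (mdiff_proj _).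
rewrite s1 => <-; have [mid tid] := tangent_id cM (proj 1%g).
rewrite -[RHS]tid (tangent_near cM _ mid)//.
have : nbhs (proj 1%g) U by apply: open_nbhs_nbhs.
by apply: filterS => q Uq /=; rewrite sE.
Qed.

(** proj is constant along a curve of H. *)
Lemma dproj_lie_subalgebra u : lie_subalgebra X H u -> dproj u = 0.
Proof.
move=> [U [c [[oU U0] cs c0 Hc <-]]].
have cR : charted (@model_atlas R R) by apply: charted_model.
have mc : mdiff (@model_atlas R R) X c 0 by apply: mdiff_smooth cs U0.
have [_ /(_ 1)] := tangent_comp cR cX mc (mdiff_proj _).
rewrite c0 => <-.
have [mcst tcst] :=
  tangent_cst (X := @model_atlas R R) (Y := XM) (proj 1%g) (0 : R).
rewrite (tangent_near cR _ mcst)//.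
have : nbhs (0 : R) U by apply: open_nbhs_nbhs.
apply: filterS => t /Hc Hct /=; apply/proj_eq.
by rewrite invg1 mul1g.
Qed.

(** Correct a curve of G with velocity u by the section:
    t |-> s(proj c(t))^-1 c(t) lies in H and has velocity
    u - ds(dproj u) = u. *)
Lemma ker_dproj u : dproj u = 0 -> lie_subalgebra X H u.
Proof.
move=> u0; have [U [s [[oU Uo] s1 sE ms sp]]] := unit_section.
pose x1 := cmap (X 1%g) 1%g; pose C := cimg (X 1%g).
(* c is the straight line with velocity u in the chart at 1 *)
pose l (t : R) := x1 + t *: u; pose c := cinv (X 1%g) \o l.
have lsm V : smooth_on V l.
  have sl : linear (fun t : R => t *: u).
    by move=> a s' t; rewrite scalerDl scalerA.
  pose S : {linear R -> 'rV[R]_n} :=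
    HB.pack (fun t : R => t *: u) (GRing.isLinear.Build _ _ _ _ _ sl).
  move=> k; apply: (@Ck_sub _ _ _ k V setT) => //.
  apply: (@Ck_add R R 'rV[R]_n k setT (cst x1) S openT); first exact: Ck_cst.
  by apply: Ck_linear; apply: scalel_continuous.
pose W0 := l @^-1` C.
have oW0 : open W0.
  have := open_preimage_on openT (cimg_open cX 1%g) (lsm setT 0%N).
  by rewrite setTI.
have l0 : l 0 = x1 by rewrite /l scale0r addr0.
have c0 : c 0 = 1%g by rewrite /c/= l0 cinvK//; apply: cdom_center.
have cp0 : param X W0 c.
  exact: (param_precomp cX (dE n) oW0 (fun _ h => h) (lsm W0) (param_cinv _ sX)).
have pc0 : param XM W0 (proj \o c) by apply: param_proj.
pose W := W0 `&` (proj \o c) @^-1` U.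
have oW : open W.
  by apply: open_preimage_on => //; case/paramP: pc0.
have W_0 : W 0.
  by split; [rewrite /W0/= l0; apply: cimg_center|rewrite /= c0].
have cp : param X W c by apply: param_sub cp0 => t [].
have pc : param XM W (proj \o c) by apply: param_sub pc0 => t [].
pose k t := ((s (proj (c t)))^-1 * c t)%g.
have sc : param X W (fun t => (s (proj (c t)))^-1)%g.
  by apply: param_inv => //; apply: (sp _ _ (proj \o c)) => // t [].
have kp : param X W k by apply: param_mul.
have cR : charted (@model_atlas R R) by apply: charted_model.
have mc : mdiff (@model_atlas R R) X c 0 by apply: mdiff_smooth cp W_0.
have msc : mdiff (@model_atlas R R) X (fun t => (s (proj (c t)))^-1)%g 0.
  by apply: mdiff_smooth sc W_0.
exists W, k; split => //.
- by rewrite /k c0 s1 mulg1 invg1.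
- move=> t [_ Ut]; apply/proj_eq; exact: sE.
rewrite (tangent_mul lieG cR msc mc) ?c0 ?s1 ?invg1//.
have cu : tangent_map (@model_atlas R R) X c 0 1 = u.
  rewrite /tangent_map c0.
  have dl : is_diff (0 : R) l (0 + *:%R^~ u) by apply: is_diffD.
  have lE : \forall t \near (0 : R), l t =
      (cmap (X 1%g) \o c \o cinv (model_atlas (0 : R))) t.
    have : nbhs (0 : R) W0 by apply: open_nbhs_nbhs; split=> //; case: W_0.
    by apply: filterS => t Ct /=; rewrite cmapK.
  by rewrite (near_eq_diff lE)// diff_val /= add0r scale1r.
have [mpc tpc] := tangent_comp cR cX mc (mdiff_proj _).
have mpc0 : proj (c 0) = proj 1%g by rewrite c0.
have [_ _ invG] := lieG.
have ms' : mdiff XM X s (proj (c 0)) by rewrite mpc0.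
have minv : mdiff X X (fun x => x^-1)%g (s (proj (c 0))).
  exact: mdiff_smooth invG _.
have [mA _] := tangent_comp cM cX ms' minv.
have [_ /(_ 1)] := tangent_comp cR cM mpc mA.
rewrite tpc cu c0 u0 [X in _ = X](linear0 ('d _ _)) => tA.
by rewrite [X in X + _]tA add0r.
Qed.

Local Notation tau := (translation proj).
Local Notation T a p := (tangent_map XM XM (tau a) p).

Lemma translation_proj a b : tau a (proj b) = proj (a * b)%g.
Proof.
rewrite /translation; apply/proj_eq.
have : proj (xget 1%g (proj @^-1` [set proj b])) = proj b.
  exact: (xgetPex 1%g (P := proj @^-1` [set proj b]) (ex_intro _ b erefl)).
by move=> /proj_eq; rewrite invgM -mulgA mulKg.
Qed.

Lemma translationM a b : tau (a * b)%g = tau a \o tau b.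
Proof.
apply/funext => p; have [c <-] := proj_surj p.
by rewrite /= !translation_proj mulgA.
Qed.

Lemma translation1 : tau 1%g = id.
Proof.
by apply/funext => p; have [c <-] := proj_surj p; rewrite translation_proj mul1g.
Qed.

Lemma mdiff_translation a p : mdiff XM XM (tau a) p.
Proof.
have [_ _ _ _ /(_ p)[U [s [[oU Up] ss sE]]]] := MGH.
have ms : mdiff XM X s p by apply: mdiff_smooth ss Up.
have [mas _] := tangent_comp cM cX ms (mdiff_mull lieG a (s p)).
have [mpas _] := tangent_comp cM cX mas (mdiff_proj _).
apply: mdiff_near mpas => //.
have : nbhs p U by apply: open_nbhs_nbhs.
by apply: filterS => q Uq /=; rewrite -[in RHS](sE q Uq) translation_proj.
Qed.

Lemma tangent_translationM a b p u : T (a * b)%g p u = T a (tau b p) (T b p u).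
Proof.
rewrite translationM.
by have [_ ->] := tangent_comp cM cM (mdiff_translation b p)
  (mdiff_translation a (tau b p)).
Qed.

Lemma tangent_translation1 p u : T 1%g p u = u.
Proof. by rewrite translation1; have [_ ->] := tangent_id cM p. Qed.

Lemma tangent_translationK a p : cancel (T a p) (T a^-1%g (tau a p)).
Proof.
by move=> u; rewrite -tangent_translationM mulVg tangent_translation1.
Qed.

Lemma tangent_translationVK a p : cancel (T a^-1%g (tau a p)) (T a p).
Proof.
move=> u; rewrite -[in X in T a X _](_ : tau a^-1%g (tau a p) = p).
  by rewrite -tangent_translationM mulgV tangent_translation1.
by rewrite -[LHS]/((tau a^-1%g \o tau a) p) -translationM mulVg translation1.
Qed.

(** For h in H the elements h x and h x h^-1 have the same class, so the
    translation by h lifts to a conjugation. *)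
Lemma tangent_translation_dproj h u : H h ->
  T h (proj 1%g) (dproj u) = dproj (Ad X h u).
Proof.
move=> Hh.
have E : tau h \o proj = proj \o conj h.
  have HVh : H h^-1%g by have [_ _] := subH; apply.
  by apply/funext => b; rewrite /= translation_proj /conj [RHS](projMr _ HVh).
have [_ <-] := tangent_comp cX cM (mdiff_proj 1%g) (mdiff_translation h _).
have [_ tE] := tangent_comp cX cX (mdiff_conj lieG h 1%g) (mdiff_proj _).
by rewrite E tE conj1.
Qed.

Lemma translation_base h : H h -> tau h (proj 1%g) = proj 1%g.
Proof. by move=> Hh; rewrite translation_proj mulg1 -{1}[h]mul1g projMr. Qed.

Lemma Ad_lie_subalgebra a u : normalizer H a ->
  lie_subalgebra X H u -> lie_subalgebra X H (Ad X a u).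
Proof.
move=> Na [U [c [[oU U0] cs c0 Hc <-]]].
have cR : charted (@model_atlas R R) by apply: charted_model.
have mc : mdiff (@model_atlas R R) X c 0 by apply: mdiff_smooth cs U0.
exists U, (conj a \o c); split=> //.
- apply: param_mul => //; last exact: param_cst.
  by apply: param_mul => //; exact: param_cst.
- by rewrite /= c0 conj1.
- by move=> t Ut; rewrite -[X in X _]Na; exists (c t) => //; apply: Hc.
- have [_ ->] := tangent_comp cR cX mc (mdiff_conj lieG a _).
  by rewrite c0.
Qed.

Lemma normalizer_subgroup : subgroup (normalizer H).
Proof.
split.
- by rewrite /normalizer /= -[RHS]image_id; congr image; exact: conj_one.
- move=> a b Na Nb; rewrite /normalizer /= -[in RHS]Na -[in RHS]Nb image_comp.
  by congr image; exact: conjM.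
- move=> a Na; rewrite /normalizer /= -[in LHS]Na image_comp -[RHS]image_id.
  by congr image; rewrite -[LHS]/(conj a^-1%g \o conj a) -conjM mulVg conj_one.
Qed.

Lemma subgroup_normalizer : H `<=` normalizer H.
Proof.
have [H1 HM HV] := subH; move=> a Ha; apply/seteqP; split=> [_ [h Hh <-]|h Hh].
  by apply: (HM); [apply: (HM)|apply: HV].
exists (a^-1 * h * a)%g; first by apply: (HM) => //; apply: (HM) => //; apply: HV.
by rewrite !mulgA mulgV mul1g mulgK.
Qed.

Section Complement.
Hypotheses (cptG : compact [set: G]) (ssG : semisimple X).
Context {m : {vspace 'rV[R]_n}}.
Hypothesis m_orth : orthogonal_complement X H m.

Lemma killing_inner : inner_product (fun u v => - killing X u v).
Proof.
split=> [u v|a u v w|u]; first by rewrite killingC.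
  by rewrite killing_linearl// opprD mulrN.
exact: neg_killing_gt0.
Qed.

(** Ad(a) is an isometry of the Killing form that maps the Lie algebra of H to
    itself, and so does Ad(a^-1). *)
Lemma Ad_complement a u : normalizer H a -> normalizer H a^-1%g ->
  u \in m -> Ad X a u \in m.
Proof.
move=> Na NVa um; apply/m_orth => v hv.
rewrite -(AdVK lieG a v) killing_Ad//.
by move/m_orth: um; apply; apply: Ad_lie_subalgebra.
Qed.

Local Notation dprojm := (fun u : subvs_of m => dproj (vsval u)).

Lemma dprojm_linear : linear dprojm.
Proof. by move=> a u v; rewrite linearP tangent_linear. Qed.

(** An element of m in the kernel of dproj lies in h, so is orthogonal to
    itself. *)
Lemma dprojm_inj : injective dprojm.
Proof.
move=> u v uv; apply/eqP; rewrite -subr_eq0; apply/eqP; set w := u - v.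
have dw : dproj (vsval w) = 0.
  by rewrite [LHS](zmod_morphism_linear dprojm_linear u v) uv subrr.
have /m_orth/(_ _ (ker_dproj dw)) := subvsP w.
by move=> /(inner_product_eq0 killing_inner) w0; apply/val_inj.
Qed.

(** Subtracting from a preimage its orthogonal projection onto the kernel of
    dproj gives a preimage in m. *)
Lemma dprojm_surj y : exists u, dprojm u = y.
Proof.
have [w <-] := dproj_surj y.
pose D : {linear 'rV[R]_n -> 'rV[R]_d} :=
  HB.pack dproj (GRing.isLinear.Build _ _ _ _ _
    (@tangent_linear _ _ _ _ _ X XM proj 1%g)).
have kP u : u \in lker (linfun D) = (dproj u == 0) by rewrite memv_ker lfunE.
have [z zk zw] := orthogonal_projection (lker (linfun D)) w killing_inner.
have wzm : w - z \in m.
  apply/m_orth => u hu; rewrite killingC//; apply: zw.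
  by rewrite kP dproj_lie_subalgebra.
exists (vsproj m (w - z)); rewrite vsprojK//.
have Dl : linear dproj := @tangent_linear _ _ _ _ _ X XM proj 1%g.
rewrite (zmod_morphism_linear Dl).
by move: zk; rewrite kP => /eqP ->; rewrite subr0.
Qed.

Lemma dprojm_inverse : exists P : 'rV[R]_d -> subvs_of m,
  [/\ linear P, cancel P dprojm & cancel dprojm P].
Proof.
have /choice[P PK] := dprojm_surj.
exists P; split=> // [a u v|u]; apply: dprojm_inj => //=.
by rewrite tangent_linear !PK.
Qed.

End Complement.

End Homogeneous.

(** * Invariant metrics and inner products at the base point *)

Section InvariantMetrics.
Context {R : realType} {n : nat} {G : topoGroupType}.
Context {X : G -> chart G 'rV[R]_n}.
Hypothesis lieG : lie_group X.
Hypotheses (cptG : compact [set: G]) (ssG : semisimple X).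
Context {H : set G}.
Hypothesis subH : subgroup H.
Context {d : nat} {M : topologicalType} {XM : M -> chart M 'rV[R]_d}.
Context {proj : G -> M}.
Hypothesis MGH : homogeneous_space X H XM proj.
Context {m : {vspace 'rV[R]_n}}.
Hypothesis m_orth : orthogonal_complement X H m.

Let sX : smooth_manifold X. Proof. by case: lieG. Qed.
Let cX : charted X. Proof. exact: smooth_manifold_charted sX. Qed.
Let sM : smooth_manifold XM. Proof. exact: homogeneous_smooth MGH. Qed.
Let cM : charted XM. Proof. exact: smooth_manifold_charted sM. Qed.

Local Notation tau := (translation proj).
Local Notation T a p := (tangent_map XM XM (tau a) p).
Local Notation dproj := (tangent_map X XM proj 1%g).
Local Notation dprojm := (fun u : subvs_of m => dproj (vsval u)).

Lemma Ad_mE a u : normalizer H a -> vsval (Ad_m X m a u) = Ad X a (vsval u).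
Proof.
move=> Na; have [_ _ NV] := normalizer_subgroup (H := H).
have Al := @Ad_linear R n G X a.
have fl : linear (fun v : subvs_of m => vsproj m (Ad X a (vsval v))).
  by move=> c v w; rewrite linearP Al linearP.
pose L : {linear subvs_of m -> subvs_of m} :=
  HB.pack (fun v => vsproj m (Ad X a (vsval v))) (GRing.isLinear.Build _ _ _ _ _ fl).
rewrite [Ad_m X m a u](lfunE L) /= vsprojK//.
by apply: (Ad_complement lieG m_orth) => //; [apply: NV|apply: subvsP].
Qed.

(** The translation by h in H fixes the base point; read there, its being an
    isometry is the Ad(h)-invariance. *)
Lemma metric_at_o_invariant g : invariant_metrics XM proj g ->
  invariant_products X m H (metric_at_o X XM proj m g).
Proof.
move=> [[gi _] giso]; have [gc gl gp] := gi (proj 1%g).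
have dl := dprojm_linear (X := X) (XM := XM) (proj := proj) (m := m).
split; first split=> [u v|a u v w|u u0].
- exact: gc.
- by rewrite /metric_at_o -!/(dprojm _) dl gl.
- apply: gp; apply: contra u0 => /eqP u0; apply/eqP.
  apply: (dprojm_inj lieG MGH cptG ssG m_orth).
  by have := zmod_morphism_linear dl 0 0; rewrite !subrr u0 => ->.
- move=> h Hh u v; have Nh := subgroup_normalizer subH Hh.
  rewrite /metric_at_o !Ad_mE// -!(tangent_translation_dproj lieG subH MGH _ Hh).
  by have := giso h (proj 1%g) (dprojm u) (dprojm v); rewrite (translation_base MGH Hh).
Qed.

(** An invariant metric is carried from the base point by the translations. *)
Lemma metric_at_o_inj g g' : invariant_metrics XM proj g ->
  invariant_metrics XM proj g' ->
  metric_at_o X XM proj m g = metric_at_o X XM proj m g' -> g = g'.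
Proof.
move=> [_ giso] [_ giso'] gg'; apply/funext => p; apply/funext => u; apply/funext => v.
have [a pa] := proj_surj MGH p.
have tao : tau a (proj 1%g) = p by rewrite (translation_proj MGH) mulg1.
rewrite -tao -(tangent_translationVK lieG MGH a (proj 1%g) u).
rewrite -(tangent_translationVK lieG MGH a (proj 1%g) v) giso giso'.
have [P [_ PK _]] := dprojm_inverse lieG MGH cptG ssG m_orth.
set u0 := (X in g _ X _); set v0 := (X in g _ _ X).
by have := congr1 (fun b => b (P u0) (P v0)) gg'; rewrite /metric_at_o !PK.
Qed.

Section Extension.
Context {b : subvs_of m -> subvs_of m -> R}.
Hypothesis bH : invariant_products X m H b.
Context {P : 'rV[R]_d -> subvs_of m}.
Hypotheses (P_linear : linear P) (PK : cancel P dprojm) (dprojmK : cancel dprojm P).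

Let bt (y z : 'rV[R]_d) : R := b (P y) (P z).

Let bt_inner : inner_product bt.
Proof.
have [[bc bl bp] _] := bH; split=> [u v|a u v w|u u0].
- exact: bc.
- by rewrite /bt P_linear bl.
- apply: bp; apply: contra u0 => /eqP Pu; apply/eqP.
  rewrite -[u]PK Pu.
  have dl := dprojm_linear (X := X) (XM := XM) (proj := proj) (m := m).
  by have := zmod_morphism_linear dl 0 0; rewrite !subrr => ->.
Qed.

Let bt_isotropy h y z : H h ->
  bt (T h (proj 1%g) y) (T h (proj 1%g) z) = bt y z.
Proof.
move=> Hh; have [_ bHh] := bH; have Nh := subgroup_normalizer subH Hh.
have PT y' : P (T h (proj 1%g) y') = Ad_m X m h (P y').
  rewrite -{1}(PK y') (tangent_translation_dproj lieG subH MGH _ Hh).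
  by rewrite -Ad_mE// dprojmK.
by rewrite /bt !PT bHh.
Qed.

Let rep p := xget 1%g (proj @^-1` [set p]).

Let repE p : proj (rep p) = p.
Proof. exact: (xgetPex 1%g (P := proj @^-1` [set p]) (proj_surj MGH p)). Qed.

(** At p = aH the inner product at the base point is pulled back by the
    translation by a^-1. *)
Let gm p u v := bt (T (rep p)^-1%g p u) (T (rep p)^-1%g p v).

(** Two representatives of p differ by an element of H, and the isotropy action
    preserves the product. *)
Let gmE a p u v : proj a = p -> gm p u v = bt (T a^-1%g p u) (T a^-1%g p v).
Proof.
move=> ap; have Hh : H (a^-1 * rep p)%g by apply/(proj_eq MGH); rewrite repE.
have tao : tau (rep p)^-1%g p = proj 1%g.
  by rewrite -{2}(repE p) (translation_proj MGH) mulVg.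
have Tw w : T a^-1%g p w = T (a^-1 * rep p)%g (proj 1%g) (T (rep p)^-1%g p w).
  by rewrite -tao -(tangent_translationM lieG MGH) mulgK.
by rewrite !Tw bt_isotropy.
Qed.

Let gm_isometry a : Defs.isometry XM gm (tau a).
Proof.
move=> p u v; have ar : proj (a * rep p)%g = tau a p.
  by rewrite -(translation_proj MGH) repE.
have E w : T (a * rep p)^-1%g (tau a p) (T a p w) = T (rep p)^-1%g p w.
  by rewrite -(tangent_translationM lieG MGH) invgM mulgVK.
by rewrite (gmE _ _ ar) !E.
Qed.

Let gm_inner p : inner_product (gm p).
Proof.
have [bc bl bp] := bt_inner; rewrite /gm; split=> [u v|a u v w|u u0].
- exact: bc.
- by rewrite tangent_linear bl.
- apply: bp; apply: contra u0 => /eqP u0; apply/eqP.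
  apply: (can_inj (tangent_translationK lieG MGH (rep p)^-1%g p)).
  rewrite u0; have Tl := @tangent_linear _ _ _ _ _ XM XM (tau (rep p)^-1%g) p.
  by have := zmod_morphism_linear Tl 0 0; rewrite !subrr => ->.
Qed.

Let gm_base : metric_at_o X XM proj m gm = b.
Proof.
apply/funext => u; apply/funext => v; rewrite /metric_at_o.
rewrite (gmE _ _ (erefl (proj 1%g))) invg1 !(tangent_translation1 MGH).
by rewrite /bt !dprojmK.
Qed.

(** With a local section s near a point, the vectors transported to the base
    point are partial derivatives, on the diagonal, of the smooth function
    (x, y) |-> s(x)^-1 s(y) H written in the charts. *)
Let gm_smooth p u v : smooth_on (cimg (XM p))
  (fun x => let q := cinv (XM p) x in
     let D := 'd (cmap (XM q) \o cinv (XM p)) x in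
     (gm q (D u) (D v) : R)).
Proof.
set F := fun x : 'rV[R]_d => _.
apply: smooth_on_local => x0 x0p.
have [_ _ _ _ /(_ (cinv (XM p) x0))[U [s [[oU Ux0] ss sE]]]] := MGH.
pose kap := cinv (XM p).
pose V := cimg (XM p) `&` kap @^-1` U.
have kapp : param XM (cimg (XM p)) kap by apply: param_cinv.
have oV : open V.
  by apply: open_preimage_on => //; [apply: cimg_open|case/paramP: kapp].
have kapV : param XM V kap by apply: param_sub kapp => x [].
have dd : fin_dim ('rV[R]_d : normedModType R) := fin_dim_rV d.
have sV : param X V (s \o kap).
  by apply: (param_comp cM cX dd oV oU _ kapV ss) => x [].
have oVV : open (V `*` V) by apply: open_setX.
have fstc : continuous (fst : 'rV[R]_d * 'rV[R]_d -> _).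
  by move=> z; apply: cvg_fst.
have sndc : continuous (snd : 'rV[R]_d * 'rV[R]_d -> _).
  by move=> z; apply: cvg_snd.
have s1 : param X (V `*` V) ((s \o kap) \o fst).
  apply: (param_precomp cX dd oVV _ _ sV); first by move=> z [].
  exact: smooth_on_linear.
have s2 : param X (V `*` V) ((s \o kap) \o snd).
  apply: (param_precomp cX dd oVV _ _ sV); first by move=> z [].
  exact: smooth_on_linear.
pose psi (z : 'rV[R]_d * 'rV[R]_d) := proj ((s (kap z.1))^-1 * s (kap z.2))%g.
have psip : param XM (V `*` V) psi.
  apply: (param_proj lieG MGH oVV); apply: param_mul => //.
  exact: param_inv.
pose o := proj 1%g; pose Psi := cmap (XM o) \o psi.
pose W := (V `*` V) `&` psi @^-1` cdom (XM o).
have oW : open W.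
  apply: open_preimage_on => //; first exact: cdom_open.
  by case/paramP: psip.
have Psis : smooth_on W Psi.
  by apply: param_smooth_on; [apply: param_sub psip => z []|move=> z []].
have diagW x : V x -> W (x, x).
  by move=> Vx; split=> //; rewrite /psi/= mulVg; apply: cdom_center.
pose f w x := 'd Psi (x, x) (0, w).
have fs w : smooth_on V (f w).
  have ds : smooth_on V (fun x : 'rV[R]_d => (x, x)).
    have ids : smooth_on V (idfun : 'rV[R]_d -> 'rV[R]_d).
      by apply: smooth_on_linear => x; apply: cvg_id.
    exact: smooth_on_pair.
  apply: (smooth_on_comp (g := fun z => 'd Psi z (0, w)) _ oV diagW ds).
    exact: fin_dim_prod.
  exact: smooth_on_diff.
have ib := bt_inner.
exists V => //; apply: (@smooth_on_ext _ _ _ V (fun x => bt (f u x) (f v x))) => //.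
  move=> x Vx; have [xp Ux] := Vx.
  pose q := kap x; pose a := s q.
  have aq : proj a = q by apply: sE.
  rewrite /F -/kap -/q (gmE _ _ aq).
  suff Tf w : T a^-1%g q ('d (cmap (XM q) \o kap) x w) = f w x by rewrite !Tf.
  have mkap : mdiff (@model_atlas R 'rV[R]_d) XM kap x.
    by apply: (mdiff_smooth _ cM kapV Vx); apply: charted_model.
  have [mtk tk] := tangent_comp (@charted_model R _) cM mkap
    (mdiff_translation lieG MGH a^-1%g q).
  have tao : (tau a^-1%g \o kap) x = o.
    by rewrite /= -/q -aq (translation_proj MGH) mulVg.
  rewrite -[LHS]tk /tangent_map tao.
  have dPsi := smooth_on_differentiable Psis (diagW x Vx).
  rewrite /f -(diff_slice _ dPsi).
  have E : \forall y \near x,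
      Psi (x, y) = (cmap (XM o) \o (tau a^-1%g \o kap)) y.
    have : nbhs x V by apply: open_nbhs_nbhs.
    apply: filterS => y [_ Uy].
    by rewrite /Psi /psi /= -[in RHS](sE _ Uy) (translation_proj MGH).
  exact: (congr1 (fun h => h w) (near_eq_diff E (differentiable_slice dPsi))).
apply: smooth_on_form => //.
- exact: (inner_product_linearl ib).
- exact: (inner_product_linearr ib).
Qed.

Lemma invariant_metric_extension : exists2 g,
  invariant_metrics XM proj g & metric_at_o X XM proj m g = b.
Proof. by exists gm; [split=> //; split|]. Qed.

End Extension.

End InvariantMetrics.

(** * Operators commuting with the isotropy representation *)

Lemma inv_lfun_comp (F : fieldType) (V : vectType F) (phi psi : 'End(V)) :
  bijective phi -> bijective psi -> ((phi \o psi)^-1 = psi^-1 \o phi^-1)%VF.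
Proof.
move=> phib psib.
have ker0 (f : 'End(V)) : bijective f -> lker f == 0%VS.
  by move=> /bij_inj ?; apply/lker0P.
have k0 : lker (phi \o psi)%VF == 0%VS.
  apply: ker0; have [phi' h1 h2] := phib; have [psi' h3 h4] := psib.
  by exists (psi' \o phi') => u; rewrite comp_lfunE/= ?h1 ?h3 ?h4 ?h2.
have E : ((phi \o psi) \o (psi^-1 \o phi^-1) = \1)%VF.
  rewrite comp_lfunA -(comp_lfunA phi) lker0_compfV ?ker0// comp_lfun1r.
  by rewrite lker0_compfV ?ker0.
by rewrite -[LHS]comp_lfun1r -E lker0_compKf.
Qed.

Lemma conj_operatorM (R : realType) n (m : {vspace 'rV[R]_n})
    (phi psi A : 'End(subvs_of m)) : bijective phi -> bijective psi ->
  conj_operator (phi \o psi)%VF A = conj_operator phi (conj_operator psi A).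
Proof.
by move=> phib psib; rewrite /conj_operator inv_lfun_comp// !comp_lfunA.
Qed.

Lemma conj_operator_fixed (R : realType) n (m : {vspace 'rV[R]_n})
    (phi A : 'End(subvs_of m)) : bijective phi ->
  conj_operator phi A = A <-> (phi \o A = A \o phi)%VF.
Proof.
move=> phib; have k0 : lker phi == 0%VS by apply/lker0P/bij_inj.
rewrite /conj_operator; split=> [E|->]; last by rewrite lker0_compfK.
by rewrite -[in RHS]E lker0_compfVK.
Qed.

Section Operators.
Context {R : realType} {n : nat} {G : topoGroupType}.
Context {X : G -> chart G 'rV[R]_n}.
Hypothesis lieG : lie_group X.
Hypotheses (cptG : compact [set: G]) (ssG : semisimple X).
Context {H : set G} {m : {vspace 'rV[R]_n}}.
Hypothesis m_orth : orthogonal_complement X H m.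

Local Notation N := (normalizer H).
Local Notation Adm := (Ad_m X m).
Local Notation B := (neg_killing X (m := m)).

Let N1 : N 1%g. Proof. by have [] := normalizer_subgroup (H := H). Qed.
Let NM a b : N a -> N b -> N (a * b)%g.
Proof. by have [_ + _] := normalizer_subgroup (H := H); apply. Qed.
Let NV a : N a -> N a^-1%g.
Proof. by have [_ _] := normalizer_subgroup (H := H); apply. Qed.

Let AdmE a u : N a -> vsval (Adm a u) = Ad X a (vsval u).
Proof. exact: (Ad_mE lieG m_orth). Qed.

Lemma normalizer_conj a h : N a -> H h -> H (a * h * a^-1)%g.
Proof. by move=> Na Hh; rewrite -[X in X _]Na; exists h. Qed.

Lemma Ad_m1 : Adm 1%g = \1%VF.
Proof.
by apply/lfunP => u; apply/val_inj; rewrite /= AdmE// Ad1// id_lfunE.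
Qed.

Lemma Ad_mM a b : N a -> N b -> Adm (a * b)%g = (Adm a \o Adm b)%VF.
Proof.
move=> Na Nb; apply/lfunP => u; apply/val_inj.
by rewrite /= comp_lfunE !AdmE// ?AdM//; apply: NM.
Qed.

Lemma Ad_mK a : N a -> cancel (Adm a) (Adm a^-1%g).
Proof.
move=> Na u; rewrite -comp_lfunE -Ad_mM//; last exact: NV.
by rewrite mulVg Ad_m1 id_lfunE.
Qed.

Lemma Ad_mVK a : N a -> cancel (Adm a^-1%g) (Adm a).
Proof. by move=> Na; have := Ad_mK (NV Na); rewrite invgK. Qed.

Lemma Ad_m_bij a : N a -> bijective (Adm a).
Proof.
by move=> Na; exists (Adm a^-1%g); [apply: Ad_mK|apply: Ad_mVK].
Qed.

Lemma Ad_mV a : N a -> (Adm a)^-1%VF = Adm a^-1%g.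
Proof.
move=> Na; have k0 : lker (Adm a) == 0%VS.
  by apply/lker0P/bij_inj/Ad_m_bij.
rewrite -[LHS]comp_lfun1r -Ad_m1 -(mulgV a) Ad_mM//; last exact: NV.
by rewrite comp_lfunA lker0_compVf// comp_lfun1l.
Qed.

Lemma subgroup_of_Aut_Ad (S : set G) : S `<=` N -> subgroup S ->
  subgroup_of_Aut [set Adm a | a in S].
Proof.
move=> SN [S1 SM SV]; split.
- by move=> _ [a /SN Na <-]; apply: Ad_m_bij.
- by exists 1%g => //; apply: Ad_m1.
- move=> _ _ [a Sa <-] [b Sb <-]; exists (a * b)%g; first exact: SM.
  by apply: Ad_mM; apply: SN.
- move=> _ [a Sa <-]; exists a^-1%g; first exact: SV.
  by rewrite Ad_mV//; apply: SN.
Qed.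

Lemma neg_killing_inner : inner_product B.
Proof. exact: inner_product_subvs (killing_inner lieG cptG ssG). Qed.

Lemma neg_killing_Ad a u v : N a -> B (Adm a u) (Adm a v) = B u v.
Proof. by move=> Na; rewrite /neg_killing !AdmE// killing_Ad. Qed.

Let ib := neg_killing_inner.

(** For operators symmetric with respect to -B, commuting with Ad(a) amounts to
    Ad(a)-invariance of the associated product, as Ad(a) preserves -B; and the
    nondegenerate form -B turns every product into an operator. *)
Lemma operator_product_bij (S : set G) : S `<=` N -> subgroup S ->
  set_bij (metric_operators X m S) (invariant_products X m S)
          (operator_product X m).
Proof.
move=> SN [_ _ SV]; have Bc := inner_productC ib.
split.
- move=> A [AS As Ap]; split; first split=> [u v|a u v w|u].
  + by rewrite /operator_product As Bc.
  + by rewrite /operator_product linearP (inner_product_linearl ib).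
  + exact: Ap.
  move=> k Sk u v; rewrite /operator_product -comp_lfunE -AS// comp_lfunE.
  by rewrite neg_killing_Ad//; apply: SN.
- move=> A A' _ _ AA'; apply/lfunP => u; apply: (inner_product_inj ib) => w.
  exact: (congr1 (fun b => b u w) AA').
- move=> b [bi bS].
  have /choice[f fE] u : exists w, forall v, B w v = b u v.
    exact: inner_product_riesz ib (inner_product_linearr bi u).
  have fl : linear f.
    move=> a u v; apply: (inner_product_inj ib) => w.
    by rewrite fE (inner_product_linearl bi) (inner_product_linearl ib) !fE.
  pose L : {linear subvs_of m -> subvs_of m} :=
    HB.pack f (GRing.isLinear.Build _ _ _ _ _ fl).
  have LE u : linfun L u = f u by rewrite lfunE.
  have [bc bl bp] := bi.
  exists (linfun L); last first.
    by apply/funext => u; apply/funext => v; rewrite /operator_product LE fE.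
  split=> [h Sh|u v|u u0].
  + have Nh := SN _ Sh; apply/lfunP => u; apply: (inner_product_inj ib) => v.
    rewrite !comp_lfunE !LE fE -(Ad_mVK Nh v) neg_killing_Ad// fE.
    by rewrite bS.
  + by rewrite !LE fE Bc fE bc.
  + by rewrite LE fE; apply: bp.
Qed.

Section Action.
Context {K : set G}.
Hypotheses (subK : subgroup K) (HK : H `<=` K) (KN : K `<=` N).

Let conjE k A : K k -> conj_operator (Adm k) A = (Adm k \o A \o Adm k^-1%g)%VF.
Proof. by move=> Kk; rewrite /conj_operator Ad_mV//; apply: KN. Qed.

(** The commutation with Ad(H) is preserved because K normalizes H. *)
Lemma conj_operator_acts :
  acts_on [set Adm k | k in K] (metric_operators X m H) conj_operator.
Proof.
split.
- move=> _ A [k Kk <-] [AH As Ap]; have Nk := KN Kk; have NVk := NV Nk.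
  have BV u v : B (Adm k u) v = B u (Adm k^-1%g v).
    by rewrite -{1}(Ad_mVK Nk v) neg_killing_Ad.
  rewrite (conjE A Kk); split=> [h Hh|u v|u u0].
  + pose h' := (k^-1 * h * k)%g.
    have Hh' : H h'.
      by have := normalizer_conj NVk Hh; rewrite invgK.
    have [Nh Nh'] := (KN (HK Hh), KN (HK Hh')).
    have hk : (h * k = k * h')%g by rewrite /h' !mulgA mulgV mul1g.
    have kh : (k^-1 * h = h' * k^-1)%g by rewrite /h' mulgK.
    have E1 : (Adm h \o Adm k = Adm k \o Adm h')%VF.
      exact: etrans (esym (Ad_mM Nh Nk)) (etrans (congr1 Adm hk) (Ad_mM Nk Nh')).
    have E2 : (Adm k^-1%g \o Adm h = Adm h' \o Adm k^-1%g)%VF.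
      exact: etrans (esym (Ad_mM NVk Nh)) (etrans (congr1 Adm kh) (Ad_mM Nh' NVk)).
    move: (Adm h) (Adm h') (Adm k) (Adm k^-1%g) E1 E2 (AH _ Hh').
    move=> p p' q r E1 E2 E3; rewrite !comp_lfunA E1 -(comp_lfunA q p' A) E3.
    by rewrite -(comp_lfunA _ r p) E2 !comp_lfunA.
  + by rewrite !comp_lfunE BV As -{1}(Ad_mK Nk (A _)) neg_killing_Ad.
  + rewrite !comp_lfunE BV; apply: Ap; apply: contra u0 => /eqP u0.
    by apply/eqP/(can_inj (Ad_mK NVk)); rewrite u0 linear0.
- move=> A _; rewrite -Ad_m1 conjE; last by case: subK.
  by rewrite invg1 Ad_m1 comp_lfun1l comp_lfun1r.
- move=> _ _ A [k /KN Nk <-] [l /KN Nl <-] _.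
  exact: conj_operatorM (Ad_m_bij Nk) (Ad_m_bij Nl).
Qed.

(** Commuting with Ad(K) contains the requirement of commuting with Ad(H). *)
Lemma fixed_operatorsE :
  fixed_operators X m H [set Adm k | k in K] = metric_operators X m K.
Proof.
apply/seteqP; split=> A.
- move=> [[AH As Ap] AK]; split=> // k Kk.
  by apply/(conj_operator_fixed _ (Ad_m_bij (KN Kk)))/AK; exists k.
- move=> [AK As Ap]; split; first by split=> // h /HK; apply: AK.
  by move=> _ [k Kk <-]; apply/(conj_operator_fixed _ (Ad_m_bij (KN Kk)))/AK.
Qed.

End Action.

End Operators.

Theorem theorem1p1 (R : realType) (n : nat) (G : topoGroupType)
    (X : G -> chart G 'rV[R]_n)
    (G_lie : lie_group X) (G_compact : compact [set: G])
    (G_semisimple : semisimple X)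
    (H : set G) (H_subgroup : subgroup H) (H_closed : closed H)
    (d : nat) (M : topologicalType) (XM : M -> chart M 'rV[R]_d)
    (proj : G -> M) (M_GH : homogeneous_space X H XM proj)
    (m : {vspace 'rV[R]_n}) (m_orth : orthogonal_complement X H m)
    (K : set G) (K_subgroup : subgroup K) (K_closed : closed K)
    (HK : H `<=` K) (KN : K `<=` normalizer H) :
  let Phi := [set Ad_m X m a | a in normalizer H] in
  let Phi_K := [set Ad_m X m k | k in K] in
  let MG := invariant_metrics XM proj in
  let MG_op := metric_operators X m H in
  let MGK := [set g | MG g /\
                invariant_products X m K (metric_at_o X XM proj m g)] in
  (* Ad(a) restricts to m for a in N_G(H), and Phi_K <= Phi <= Aut(m) *)
  [/\ forall a, normalizer H a -> forall u, u \in m -> Ad X a u \in m,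
      subgroup_of_Aut Phi, subgroup_of_Aut Phi_K & Phi_K `<=` Phi]
  /\ (* the identifications of M^G *)
  [/\ set_bij MG (invariant_products X m H) (metric_at_o X XM proj m) &
      set_bij MG_op (invariant_products X m H) (operator_product X m)]
  /\ (* (1) *)
  acts_on Phi_K MG_op conj_operator
  /\ (* (2) *)
  [/\ operator_product X m @` fixed_operators X m H Phi_K =
        invariant_products X m K,
      invariant_products X m K `<=` invariant_products X m H,
      MGK `<=` MG &
      metric_at_o X XM proj m @` MGK = invariant_products X m K].
Proof.
move=> Phi Phi_K MG MG_op MGK.
have HN := subgroup_normalizer H_subgroup.
have sN : subgroup (normalizer H) := normalizer_subgroup.
have KH : invariant_products X m K `<=` invariant_products X m H.
  by move=> b [bi bK]; split=> // h /HK; apply: bK.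
have bij_op S := operator_product_bij G_lie G_compact G_semisimple m_orth (S := S).
have bij_at_o : set_bij MG (invariant_products X m H) (metric_at_o X XM proj m).
  split.
  - by move=> g; apply: metric_at_o_invariant.
  - move=> g g' /set_mem MGg /set_mem MGg'.
    exact: (metric_at_o_inj G_lie G_compact G_semisimple M_GH m_orth MGg MGg').
  - move=> b bH.
    have [P [Pl PK KP]] := dprojm_inverse G_lie M_GH G_compact G_semisimple m_orth.
    have [g MGg gb] :=
      invariant_metric_extension G_lie H_subgroup M_GH m_orth bH Pl PK KP.
    by exists g.
split; [split|split; [split|split; [|split]]].
- move=> a Na u; apply: (Ad_complement G_lie m_orth) => //.
  by have [_ _] := sN; apply.
- exact: (subgroup_of_Aut_Ad G_lie m_orth).
- exact: (subgroup_of_Aut_Ad G_lie m_orth).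
- by move=> _ [k /KN Nk <-]; exists k.
- exact: bij_at_o.
- exact: bij_op.
- exact: (conj_operator_acts G_lie m_orth).
- rewrite (fixed_operatorsE G_lie m_orth HK KN).
  have [opK _ op_surj] := bij_op _ KN K_subgroup; apply/seteqP.
  by split=> // _ [A /opK ? <-].
- exact: KH.
- by move=> g [].
- apply/seteqP; split=> [_ [g [_ gK] <-]//|b bK].
  have [_ _ /(_ b (KH b bK))[g MGg gb]] := bij_at_o.
  by exists g => //; split=> //; rewrite gb.
Qed.
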